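(* For an indeterminate Hamburger moment problem let $T_t$, $t\in\mathbb{R}\cup\{\infty\}$, be the self-adjoint extensions of the Jacobi operator and $\mu_t$ the corresponding N-extremal measures. For $\lambda\in\mathbb{C}$ and $t\in\mathbb{R}\cup\{\infty\}$ we have $$\mathfrak{p}_\lambda\in D(T_t)\iff D(\lambda,x)=0\ \ \forall x\in\operatorname{supp}(\mu_t)\iff\lambda\in\operatorname{supp}(\mu_t),$$ $$\mathfrak{q}_\lambda\in D(T_t)\iff C(\lambda,x)=0\ \ \forall x\in\operatorname{supp}(\mu_t).$$
   Context: Setting: $s=(s_n)_{n\ge0}$, $s_0=1$, is an indeterminate Hamburger moment sequence, i.e. $s_n=\int x^n\,d\mu(x)$ for all $n\ge 0$ for more than one positive measure $\mu$ on $\mathbb{R}$ (with infinite support); $V$ is the set of all such $\mu$ (probability measures). $(p_n)_{n\ge0}$ are the orthonormal polynomials ($\deg p_n=n$, positive leading coefficient, $p_0=1$, $\int p_np_m\,d\mu=\delta_{n,m}$), satisfying $xp_n=a_np_{n+1}+b_np_n+a_{n-1}p_{n-1}$, $a_n>0$, $b_n\in\mathbb{R}$, $a_{-1}:=0$. The polynomials of the second kind are $q_n(z)=\int\frac{p_n(z)-p_n(x)}{z-x}\,d\mu(x)$, $\mu\in V$ arbitrary. It is known that $\mathfrak{p}_z:=(p_n(z))_{n\ge0}$ and $\mathfrak{q}_z:=(q_n(z))_{n\ge0}$ belong to $\ell^2$ for every $z\in\mathbb{C}$. Jacobi operator: $J$ is the tridiagonal matrix acting by $(Jc)_n=a_{n-1}c_{n-1}+b_nc_n+a_nc_{n+1}$,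 $n\ge0$, and $\mathcal F\subset\ell^2$ is the space of complex sequences with finitely many non-zero terms. The Jacobi operator $(T,D(T))$ is the closure in the complex Hilbert space $\ell^2$ of $(J,\mathcal F)$. It is symmetric with deficiency indices $(1,1)$; its adjoint $T^*$ has domain $D(T^* )=\{c\in\ell^2: Jc\in\ell^2\}$ and $T^*c=Jc$. Self-adjoint extensions and N-extremal measures: for $t\in\mathbb{R}^*:=\mathbb{R}\cup\{\infty\}$, $T_t$ is the restriction of $T^*$ to $D(T_t)=D(T)\oplus\mathbb{C}(\mathfrak{q}_0+t\mathfrak{p}_0)$ for $t\in\mathbb{R}$, and $D(T_\infty)=D(T)\oplus\mathbb{C}\mathfrak{p}_0$; these are the self-adjoint extensions of $T$ in $\ell^2$. With $E_t$ the spectral measure of $T_t$ and $e_0=(1,0,0,\dots)$, the N-extremal measure is $\mu_t(\cdot):=\langle E_t(\cdot)e_0,e_0\rangle\in V$. It is known that $\mu_t$ is discrete. Nevanlinna functions (entire on $\mathbb{C}^2$): $C(u,v)=1+(u-v)\sum_{k=0}^\infty q_k(u)p_k(v)$, $D(u,v)=(u-v)\sum_{k=0}^\infty p_k(u)p_k(v)$. *)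

(* Defs.v *)
From HB Require Import structures.
From mathcomp Require Import all_boot all_order all_algebra.
From mathcomp Require Import all_classical all_reals all_analysis.
From mathcomp Require Import complex.
Set Implicit Arguments.
Unset Strict Implicit.
Unset Printing Implicit Defensive.
Import Order.TTheory GRing.Theory Num.Theory numFieldNormedType.Exports.
Local Open Scope classical_set_scope.
Local Open Scope ring_scope.
Local Open Scope complex_scope.

Section Measures.
Context {R : realType}.

Definition supp (mu : set R -> \bar R) : set R :=
  [set x | forall U : set R, open U -> U x -> (0 < mu U)%E].

(* mu is in V; as s_0 = 1, the solutions are probabilities. *)
Definition moment_solution (s : nat -> R)
    (mu : probability (measurableTypeR R) R) : Prop :=
  infinite_set (supp mu) /\
  forall n, mu.-integrable setT (fun x => (x ^+ n)%:E) /\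
    (\int[mu]_x (x ^+ n)%:E = (s n)%:E)%E.

Definition indeterminate (s : nat -> R) : Prop :=
  exists mu nu : probability (measurableTypeR R) R,
    [/\ moment_solution s mu, moment_solution s nu
      & exists2 B : set (measurableTypeR R), measurable B & mu B <> nu B].

Definition orthonormal_polys (mu : probability (measurableTypeR R) R)
    (p : nat -> {poly R}) : Prop :=
  [/\ forall n, size (p n) = n.+1,
      forall n, 0 < lead_coef (p n),
      p 0%N = 1
    & forall n m, (\int[mu]_x ((p n).[x] * (p m).[x]) = (n == m)%:R)%R].

(* x p_n = a_n p_(n+1) + b_n p_n + a_(n-1) p_(n-1), with a_(-1) = 0 *)
Definition three_term (p : nat -> {poly R}) (a b : nat -> R) : Prop :=
  (forall n, 0 < a n) /\
  forall n, 'X * p n = a n *: p n.+1 + b n *: p n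
                       + (if n is m.+1 then a m *: p m else 0).

Definition Cintegral (mu : probability (measurableTypeR R) R)
    (f : R -> R[i]) : R[i] :=
  (\int[mu]_x (complex.Re (f x)))%R +i* (\int[mu]_x (complex.Im (f x)))%R.

Definition pseq (p : nat -> {poly R}) (z : R[i]) : nat -> R[i] :=
  fun n => (map_poly (real_complex R) (p n)).[z].

(* (f z - f x) / (z - x) as a polynomial in (z, x): its value on the diagonal
   is the derivative. *)
Definition divided_difference (f : {poly R[i]}) (z x : R[i]) : R[i] :=
  if x == z then f^`().[z] else (f.[z] - f.[x]) / (z - x).

Definition qseq (mu : probability (measurableTypeR R) R)
    (p : nat -> {poly R}) (z : R[i]) : nat -> R[i] :=
  fun n => Cintegral mu (fun x =>
    divided_difference (map_poly (real_complex R) (p n)) z x%:C).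

End Measures.

Section SequenceSpace.
Context {R : realType}.
Implicit Types c d : nat -> R[i].

Definition csum (u : nat -> R[i]) : R[i] :=
  limn (series (u : nat -> R[i]^o)).

Definition l2 : set (nat -> R[i]) :=
  [set c | cvgn (series (fun n => Normc.normc (c n) ^+ 2))].

Definition l2norm c : R :=
  Num.sqrt (limn (series (fun n => Normc.normc (c n) ^+ 2))).

Definition l2cvg (f : nat -> nat -> R[i]) c : Prop :=
  l2norm (f k \- c) @[k --> \oo] --> (0 : R).

Definition inner c d : R[i] := csum (fun n => c n * (d n)^*).

Definition finsupp : set (nat -> R[i]) :=
  [set c | exists N, forall n, (N <= n)%N -> c n = 0].

Definition e0 : nat -> R[i] := fun n => (n == 0%N)%:R.

Definition jacobi (a b : nat -> R) c : nat -> R[i] :=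
  fun n => (if n is m.+1 then (a m)%:C * c m else 0)
           + (b n)%:C * c n + (a n)%:C * c n.+1.

(* Domain of the closure T of (J, F).  As T is a restriction of its adjoint
   T^*, it acts on this domain by jacobi, as do all its extensions below. *)
Definition dom_T (a b : nat -> R) : set (nat -> R[i]) :=
  [set c | l2 c /\ exists d, l2 d /\
    exists f : nat -> nat -> R[i],
      [/\ forall k, finsupp (f k), l2cvg f c
        & l2cvg (fun k => jacobi a b (f k)) d]].

(* Domain of T_t for t = Some r (real r) and t = None (infinity); p0 and q0
   stand for the sequences (p_n(0)) and (q_n(0)). *)
Definition dom_Tt (a b : nat -> R) (p0 q0 : nat -> R[i]) (t : option R) :
    set (nat -> R[i]) :=
  let v := if t is Some r then fun n => q0 n + r%:C * p0 n else p0 in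
  [set c | exists2 d, dom_T a b d &
     exists alpha : R[i], c = (fun n => d n + alpha * v n)].

Definition orthogonal_projection (P : (nat -> R[i]) -> (nat -> R[i])) : Prop :=
  [/\ forall c, l2 c -> l2 (P c),
      forall (alpha : R[i]) c d, l2 c -> l2 d ->
        P (fun n => alpha * c n + d n) = (fun n => alpha * P c n + P d n),
      forall c, l2 c -> P (P c) = P c
    & forall c d, l2 c -> l2 d -> inner (P c) d = inner c (P d)].

Definition projection_valued_measure
    (E : set R -> (nat -> R[i]) -> (nat -> R[i])) : Prop :=
  [/\ forall B : set (measurableTypeR R), measurable B ->
        orthogonal_projection (E B),
      forall c, l2 c -> E setT c = c
    & forall B : nat -> set (measurableTypeR R),
        (forall k, measurable (B k)) -> trivIset setT B ->
        forall c, l2 c ->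
        l2cvg (fun N n => \sum_(k < N) E (B k) c n) (E (\bigcup_k B k) c)].

(* The operator A with domain D is the integral of x against dE(x):
   c lies in D iff x is square integrable for the measure <E(.)c, c>, and then
   <A c, c> is the integral of x for this measure. *)
Definition spectral_measure (D : set (nat -> R[i]))
    (A : (nat -> R[i]) -> (nat -> R[i]))
    (E : set R -> (nat -> R[i]) -> (nat -> R[i])) : Prop :=
  [/\ projection_valued_measure E, D `<=` l2
    & forall c, l2 c ->
      exists m : {measure set (measurableTypeR R) -> \bar R},
        [/\ forall B : set (measurableTypeR R), measurable B ->
              m B = (complex.Re (inner (E B c) c))%:E,
            D c <-> (\int[m]_x (x ^+ 2)%:E < +oo)%E
          & D c -> inner (A c) c = ((\int[m]_x x)%R)%:C]].

Definition nextremal (E : set R -> (nat -> R[i]) -> (nat -> R[i])) :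
    set R -> \bar R :=
  fun B => (complex.Re (inner (E B e0) e0))%:E.

Definition nevanlinna_C (p q : R[i] -> nat -> R[i]) (u v : R[i]) : R[i] :=
  1 + (u - v) * csum (fun k => q u k * p v k).

Definition nevanlinna_D (p : R[i] -> nat -> R[i]) (u v : R[i]) : R[i] :=
  (u - v) * csum (fun k => p u k * p v k).

End SequenceSpace.

(* Main.v *)
Require Import Defs.
From HB Require Import structures.
From mathcomp Require Import all_boot all_order all_algebra.
From mathcomp Require Import all_classical all_reals all_analysis.
From mathcomp Require Import complex measurable_realfun.
From mathcomp Require Import ring lra zify.
Import Order.TTheory GRing.Theory Num.Theory numFieldNormedType.Exports.
Local Open Scope classical_set_scope.
Local Open Scope ring_scope.
Local Open Scope complex_scope.
Set Implicit Arguments.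
Unset Strict Implicit.
Unset Printing Implicit Defensive.
Local Notation Re := complex.Re.
Local Notation Im := complex.Im.

(** The theorem rests on the boundary form [<J c, w> - <c, J w>] on the domain
    of [T^*], the set of [c] in [l^2] with [J c] in [l^2]. It vanishes when one
    argument lies in [D(T)], and the quotient of the domain of [T^*] by [D(T)] is
    spanned by the classes of [p_0] and [q_0], on which the form is
    nondegenerate. Hence [D(T_t)] consists of the [c] whose boundary form with
    [q_0 + t p_0] (with [p_0] for [t] infinite) vanishes ([dom_TtP]). Since
    [J p_z = z p_z] and [J q_z = z q_z + e_0], the boundary forms of
    [p_lambda] and [q_lambda] with [p_x], [x] real, are [D(lambda, x)] and
    [C(lambda, x)].

    The second ingredient is that the support of [mu_t] is the set of real [x]
    with [p_x] in [D(T_t)]. An eigenvector [p_x] lies in the range of the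
    spectral projection of each neighbourhood of [x], and its first entry is 1,
    so [e_0] has positive weight there ([eigenvalue_supp]). Conversely, if [e_0]
    has weight near [x], its projections to small intervals around [x] are
    approximate eigenvectors, and variation of constants with the square
    summable solutions [p_x] and [q_x] shows that they approach multiples of
    [p_x] ([supp_eigenvector]). For a support point [x], the eigenvector [p_x] is
    not in [D(T)], because its boundary form with [q_x] is not 0. So [D(T_t)] is
    spanned by [D(T)] and [p_x], and its elements are the [c] whose boundary
    form with [p_x] vanishes, for one or for all [x] in the support
    ([domain_boundary_criterion]). Finally, eigenvalues of a symmetric operator
    are real, so [p_lambda] is in [D(T_t)] exactly when [lambda] is in the
    support.

    The spectral measure is only given through the weights [<E(.) c, c>], the
    domain and the quadratic form. That [A] commutes with the projections [E B]
    follows because vectors [u] and [v] in the ranges of [E B] and of its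
    complement have singular weights: the quadratic form is additive on
    [u + v] and on [u + i v], which forces [<A u, v> = 0]
    ([inner_A_orthogonal]).

    Square summability of [p_z] and [q_z] comes from indeterminacy. For a
    solution [nu] and nonreal [z], the Fourier coefficients of [1 / (x - z)] are
    [q_z + w p_z], where [w] is the Cauchy transform of [nu] at [z], and Bessel's
    inequality makes them square summable. Two solutions have different Cauchy
    transforms at some [z], because the transform determines the measure
    ([cauchy_transform_unique]): iterated square roots and partial fractions
    turn the kernels into [1 / (1 + s^(2^j))], whose limits are, up to the values
    at the end points, indicators of intervals. Subtracting gives [p_z], then [q_z], at this [z], and a discrete
    Gronwall estimate carries both to all other parameters
    ([l2_change_parameter]). *)

(** * Complex numbers and complex series *)

Section ComplexScalars.
Variable R : realType.
Implicit Types z w : R[i].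
Local Notation normc := (@Normc.normc R).

Lemma conjE z : Num.conj z = conjc z. Proof. by []. Qed.

Lemma normc_ge0 z : 0 <= normc z.
Proof. by case: z => x y; exact: sqrtr_ge0. Qed.

Lemma normc_sq z : normc z ^+ 2 = Re z ^+ 2 + Im z ^+ 2.
Proof. by case: z => x y /=; rewrite sqr_sqrtr // addr_ge0 ?sqr_ge0. Qed.

Lemma mul_conj_norm z : z * Num.conj z = (normc z ^+ 2)%:C.
Proof.
by rewrite normc_sq; case: z => x y; rewrite conjE; simpc; congr (_ +i* _); ring.
Qed.

Lemma normc_real (x : R) : normc x%:C = `|x|.
Proof. by rewrite /= expr0n /= addr0 sqrtr_sqr. Qed.

Lemma normc_conj z : normc (Num.conj z) = normc z.
Proof. by case: z => x y; rewrite conjE /= sqrrN. Qed.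

Lemma normcD z w : normc (z + w) <= normc z + normc w.
Proof. exact: le_normcD. Qed.

Lemma normcB z w : normc (z - w) <= normc z + normc w.
Proof. by apply: le_trans (normcD _ _) _; rewrite -(normcN w). Qed.

Lemma normc_sum (F : nat -> R[i]) n :
  normc (\sum_(i < n) F i) <= \sum_(i < n) normc (F i).
Proof.
elim/big_rec2: _ => [|i x y _ IH]; first by rewrite Normc.normc0.
by apply: le_trans (normcD _ _) _; rewrite lerD2l.
Qed.

Lemma abs_Re_le z : `|Re z| <= normc z.
Proof. by case: z => x y /=; rewrite -sqrtr_sqr ler_wsqrtr // lerDl sqr_ge0. Qed.

Lemma abs_Im_le z : `|Im z| <= normc z.
Proof. by case: z => x y /=; rewrite -sqrtr_sqr ler_wsqrtr // lerDr sqr_ge0. Qed.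

Lemma ReD z w : Re (z + w) = Re z + Re w. Proof. by case: z w => [? ?] []. Qed.
Lemma ImD z w : Im (z + w) = Im z + Im w. Proof. by case: z w => [? ?] []. Qed.
Lemma ReM z w : Re (z * w) = Re z * Re w - Im z * Im w.
Proof. by case: z w => [? ?] []. Qed.
Lemma ImM z w : Im (z * w) = Re z * Im w + Im z * Re w.
Proof. by case: z w => [? ?] []. Qed.
Lemma complex_eqP z w : Re z = Re w -> Im z = Im w -> z = w.
Proof. by case: z w => [? ?] [? ?] /= -> ->. Qed.

End ComplexScalars.

Section ComplexSeries.
Variable R : realType.
Implicit Types (u v : nat -> R[i]) (k l : R[i]).

(** The balls of [R[i]] have complex radii; convergence is handled on the real
    and imaginary parts, where the theory of real series applies. *)
Definition has_csum u l :=
  series (fun n => Re (u n)) @ \oo --> Re l /\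
  series (fun n => Im (u n)) @ \oo --> Im l.

Lemma series_Re u n : Re (series (u : nat -> R[i]^o) n) = series (fun n => Re (u n)) n.
Proof.
rewrite /series /=; elim: n => [|n IH]; first by rewrite !big_geq.
by rewrite !big_nat_recr //= ReD IH.
Qed.

Lemma series_Im u n : Im (series (u : nat -> R[i]^o) n) = series (fun n => Im (u n)) n.
Proof.
rewrite /series /=; elim: n => [|n IH]; first by rewrite !big_geq.
by rewrite !big_nat_recr //= ImD IH.
Qed.

Lemma has_csum_close (l s e : R[i]) : Im e = 0 ->
  `|Re l - Re s| < Re e / 2 -> `|Im l - Im s| < Re e / 2 -> `|l - s| < e.
Proof.
case: l s e => [l1 l2] [s1 s2] [e1 e2] /= -> hr hi.
have -> : (l1 +i* l2) - (s1 +i* s2) = (l1 - s1)%:C + (0 +i* 1) * (l2 - s2)%:C.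
  by simpc.
apply: le_lt_trans (ler_normD _ _) _; rewrite normrM !normc_def /=.
rewrite !expr0n /= expr1n add0r !addr0 sqrtr1 mul1r !sqrtr_sqr.
by rewrite -rmorphD ltcR [ltRHS]splitr ltrD.
Qed.

Lemma has_csum_csum u l : has_csum u l -> csum u = l.
Proof.
move=> [hre him]; apply: (@cvg_lim R[i]^o) => //.
apply/cvgrPdist_lt => e; rewrite ltcE => /andP[/= /eqP ime e0].
have e20 : 0 < Re e / 2 by rewrite divr_gt0.
move/cvgrPdist_lt/(_ _ e20) : hre => hre.
move/cvgrPdist_lt/(_ _ e20) : him => him.
near=> n; apply: (@has_csum_close _ _ e) => //.
  by rewrite series_Re; near: n; exact: hre.
by rewrite series_Im; near: n; exact: him.
Unshelve. all: by end_near. Qed.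

Lemma has_csumD u v l k : has_csum u l -> has_csum v k ->
  has_csum (fun n => u n + v n) (l + k).
Proof.
have seriesD (f g : nat -> R) : series (fun n => f n + g n) = series f \+ series g.
  by apply/funext => n; rewrite /series /= big_split.
move=> [u1 u2] [v1 v2]; split.
  under eq_fun do rewrite ReD.
  by rewrite ReD seriesD; exact: cvgD.
under eq_fun do rewrite ImD.
by rewrite ImD seriesD; exact: cvgD.
Qed.

Lemma has_csumZ k u l : has_csum u l -> has_csum (fun n => k * u n) (k * l).
Proof.
have seriesL (a b : R) (f g : nat -> R) :
    series (fun n => a * f n + b * g n) = (fun n => a * series f n + b * series g n).
  by apply/funext => n; rewrite /series /= big_split !mulr_sumr.
move=> [u1 u2]; split.
  under eq_fun do rewrite ReM -mulNr.
  rewrite ReM -mulNr seriesL.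
  by apply: cvgD; apply: cvgMl_tmp.
under eq_fun do rewrite ImM.
rewrite ImM seriesL.
by apply: cvgD; apply: cvgMl_tmp.
Qed.

Lemma has_csum_conj u l : has_csum u l ->
  has_csum (fun n => Num.conj (u n)) (Num.conj l).
Proof.
have ReJ (z : R[i]) : Re (Num.conj z) = Re z by case: z.
have ImJ (z : R[i]) : Im (Num.conj z) = - Im z by case: z.
have seriesN (f : nat -> R) : series (fun n => - f n) = (fun n => - series f n).
  by apply/funext => n; rewrite /series /= sumrN.
move=> [u1 u2]; split.
  by under eq_fun do rewrite ReJ; rewrite ReJ.
under eq_fun do rewrite ImJ.
by rewrite ImJ seriesN; exact: cvgN.
Qed.

Lemma has_csum_abs u (v : nat -> R) : cvgn (series v) ->
  (forall n, Normc.normc (u n) <= v n) -> has_csum u (csum u).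
Proof.
move=> cv le_uv.
have dom (f : nat -> R) : (forall n, `|f n| <= v n) ->
    series f @ \oo --> limn (series f).
  move=> le_fv; apply: normed_cvg; apply: series_le_cvg cv => //= n.
  exact: le_trans (normr_ge0 _) (le_fv n).
suff H : has_csum u (limn (series (fun n => Re (u n))) +i* limn (series (fun n => Im (u n)))).
  by rewrite (has_csum_csum H).
split; apply: dom => n.
  exact: le_trans (abs_Re_le _) (le_uv n).
exact: le_trans (abs_Im_le _) (le_uv n).
Qed.

End ComplexSeries.

(** * The Hilbert space of square summable sequences *)

Section L2Space.
Variable R : realType.
Implicit Types (c d : nat -> R[i]) (alpha : R[i]).
Local Notation normc := (@Normc.normc R).

Lemma sq_normcD_le (z w : R[i]) :
  normc (z + w) ^+ 2 <= 2 * normc z ^+ 2 + 2 * normc w ^+ 2.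
Proof.
rewrite !normc_sq ReD ImD -subr_ge0.
have := sqr_ge0 (Re z - Re w); have := sqr_ge0 (Im z - Im w).
by move=> h1 h2; nra.
Qed.

Lemma l2_bounded c (M : R) :
  (forall N, \sum_(n < N) normc (c n) ^+ 2 <= M) -> l2 c.
Proof.
move=> leM; apply: nondecreasing_is_cvgn.
  by apply: nondecreasing_series => n _ _; exact: sqr_ge0.
by exists M => _ [N _ <-]; rewrite /series /= big_mkord.
Qed.

Lemma l2_dominated c (v : nat -> R) : cvgn (series v) ->
  (forall n, normc (c n) ^+ 2 <= v n) -> l2 c.
Proof.
move=> cv le_cv; apply: series_le_cvg cv => // n; first exact: sqr_ge0.
exact: le_trans (sqr_ge0 _) (le_cv n).
Qed.

Lemma l2_lin alpha c d : l2 c -> l2 d -> l2 (fun n => alpha * c n + d n).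
Proof.
move=> l2c l2d; pose K := normc alpha ^+ 2.
apply: (@l2_dominated _ (fun n => (2 * K) * normc (c n) ^+ 2 + 2 * normc (d n) ^+ 2)).
  rewrite (_ : series _ = fun N => 2 * K * series (fun n => normc (c n) ^+ 2) N +
             2 * series (fun n => normc (d n) ^+ 2) N); last first.
    by apply/funext => N; rewrite /series /= big_split /= !mulr_sumr.
  by apply: is_cvgD; apply: is_cvgMl_tmp.
move=> n; apply: le_trans (sq_normcD_le _ _) _.
by rewrite Normc.normcM exprMn mulrA.
Qed.

Lemma l2_0 : l2 (fun=> 0 : R[i]).
Proof.
apply: (@l2_bounded _ 0) => N; rewrite big1 // => n _.
by rewrite Normc.normc0 expr0n.
Qed.

Lemma l2Z alpha c : l2 c -> l2 (fun n => alpha * c n).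
Proof.
move=> l2c; rewrite (_ : (fun _ => _) = fun n => alpha * c n + 0).
  exact: l2_lin l2c l2_0.
by apply/funext => n; rewrite addr0.
Qed.

Lemma l2D c d : l2 c -> l2 d -> l2 (fun n => c n + d n).
Proof.
move=> l2c l2d; rewrite (_ : (fun _ => _) = fun n => 1 * c n + d n).
  exact: l2_lin.
by apply/funext => n; rewrite mul1r.
Qed.

Lemma l2B c d : l2 c -> l2 d -> l2 (fun n => c n - d n).
Proof.
move=> l2c l2d; rewrite (_ : (fun _ => _) = fun n => -1 * d n + c n).
  exact: l2_lin.
by apply/funext => n; rewrite mulN1r addrC.
Qed.

Lemma finsupp_l2 c : finsupp c -> l2 c.
Proof.
move=> [N c0]; apply: (@l2_bounded _ (\sum_(n < N) normc (c n) ^+ 2)) => M.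
rewrite -!(big_mkord xpredT (fun n => normc (c n) ^+ 2)).
have [leMN|/ltnW leNM] := leqP M N.
  by rewrite [leRHS](big_cat_nat (leq0n M) leMN) //= lerDl sumr_ge0 // => n _; exact: sqr_ge0.
rewrite (big_cat_nat (leq0n N) leNM) //= [X in _ + X]big_nat_cond [X in _ + X]big1 ?addr0 // => n.
by rewrite andbT => /andP[Nn _]; rewrite c0 // Normc.normc0 expr0n.
Qed.

Lemma has_inner c d : l2 c -> l2 d ->
  has_csum (fun n => c n * Num.conj (d n)) (inner c d).
Proof.
move=> l2c l2d.
apply: (@has_csum_abs _ _ (fun n => normc (c n) ^+ 2 + normc (d n) ^+ 2)).
  rewrite (_ : series _ = series (fun n => normc (c n) ^+ 2) \+
             series (fun n => normc (d n) ^+ 2)); last first.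
    by apply/funext => N; rewrite /series /= big_split.
  exact: is_cvgD.
move=> n; rewrite Normc.normcM normc_conj.
have := sqr_ge0 (normc (c n) - normc (d n)).
have := normc_ge0 (c n); have := normc_ge0 (d n); nra.
Qed.

Lemma inner_linl alpha c c' d : l2 c -> l2 c' -> l2 d ->
  inner (fun n => alpha * c n + c' n) d = alpha * inner c d + inner c' d.
Proof.
move=> l2c l2c' l2d; apply: has_csum_csum.
under eq_fun do rewrite mulrDl -mulrA.
exact: has_csumD (has_csumZ alpha (has_inner l2c l2d)) (has_inner l2c' l2d).
Qed.

Lemma inner_conj c d : l2 c -> l2 d -> inner d c = Num.conj (inner c d).
Proof.
move=> l2c l2d; apply: has_csum_csum.
have := has_csum_conj (has_inner l2c l2d).
by under eq_fun do rewrite rmorphM /= conjCK mulrC.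
Qed.

Lemma inner_linr alpha c d d' : l2 c -> l2 d -> l2 d' ->
  inner c (fun n => alpha * d n + d' n) = Num.conj alpha * inner c d + inner c d'.
Proof.
move=> l2c l2d l2d'; rewrite inner_conj ?inner_linl //; last exact: l2_lin.
by rewrite rmorphD rmorphM /= -!inner_conj.
Qed.

Lemma inner0l d : inner (fun=> 0) d = 0.
Proof.
apply: has_csum_csum; split; rewrite /series /=.
  under eq_fun do (rewrite big1; last by move=> *; rewrite mul0r).
  exact: cvg_cst.
under eq_fun do (rewrite big1; last by move=> *; rewrite mul0r).
exact: cvg_cst.
Qed.

Lemma innerZl alpha c d : l2 c -> l2 d ->
  inner (fun n => alpha * c n) d = alpha * inner c d.
Proof.
move=> l2c l2d; apply: has_csum_csum; under eq_fun do rewrite -mulrA.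
exact: has_csumZ (has_inner l2c l2d).
Qed.

Lemma innerDl c c' d : l2 c -> l2 c' -> l2 d ->
  inner (fun n => c n + c' n) d = inner c d + inner c' d.
Proof.
move=> l2c l2c' l2d; apply: has_csum_csum; under eq_fun do rewrite mulrDl.
exact: has_csumD (has_inner l2c l2d) (has_inner l2c' l2d).
Qed.

Lemma innerBl c c' d : l2 c -> l2 c' -> l2 d ->
  inner (fun n => c n - c' n) d = inner c d - inner c' d.
Proof.
move=> l2c l2c' l2d.
have -> : (fun n => c n - c' n) = (fun n => c n + -1 * c' n).
  by apply/funext => n; rewrite mulN1r.
by rewrite innerDl ?innerZl ?mulN1r //; exact: l2Z.
Qed.

Lemma innerZr alpha c d : l2 c -> l2 d ->
  inner c (fun n => alpha * d n) = Num.conj alpha * inner c d.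
Proof.
move=> l2c l2d; rewrite inner_conj ?innerZl //; last exact: l2Z.
by rewrite rmorphM /= -!inner_conj.
Qed.

Lemma innerDr c d d' : l2 c -> l2 d -> l2 d' ->
  inner c (fun n => d n + d' n) = inner c d + inner c d'.
Proof.
move=> l2c l2d l2d'; rewrite inner_conj ?innerDl //; last exact: l2D.
by rewrite rmorphD /= -!inner_conj.
Qed.

Lemma innerBr c d d' : l2 c -> l2 d -> l2 d' ->
  inner c (fun n => d n - d' n) = inner c d - inner c d'.
Proof.
move=> l2c l2d l2d'; rewrite inner_conj ?innerBl //; last exact: l2B.
by rewrite rmorphB /= -!inner_conj.
Qed.

Lemma sqnorm_limn_ge0 c : l2 c -> 0 <= limn (series (fun n => normc (c n) ^+ 2)).
Proof.
move=> l2c; apply: limr_ge => //; near=> N.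
by apply: sumr_ge0 => n _; exact: sqr_ge0.
Unshelve. all: by end_near. Qed.

Lemma inner_norm c : l2 c -> inner c c = (l2norm c ^+ 2)%:C.
Proof.
move=> l2c; rewrite sqr_sqrtr ?sqnorm_limn_ge0 //.
apply: has_csum_csum; under eq_fun do rewrite mul_conj_norm.
split => //=; rewrite /series /=.
under eq_fun do rewrite big1 //.
exact: cvg_cst.
Qed.

Lemma l2norm_ge0 c : 0 <= l2norm c.
Proof. exact: sqrtr_ge0. Qed.

Lemma l2norm_partial_sum c N : l2 c -> \sum_(n < N) normc (c n) ^+ 2 <= l2norm c ^+ 2.
Proof.
move=> l2c; rewrite sqr_sqrtr ?sqnorm_limn_ge0 //.
rewrite -(big_mkord xpredT (fun n => normc (c n) ^+ 2)).
apply: (nondecreasing_cvgn_le _ l2c N).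
by apply: nondecreasing_series => n _ _; exact: sqr_ge0.
Qed.

Lemma l2norm_le c (M : R) : 0 <= M ->
  (forall N, \sum_(n < N) normc (c n) ^+ 2 <= M ^+ 2) -> l2norm c <= M.
Proof.
move=> M0 leM; rewrite -[leRHS]ger0_norm // -sqrtr_sqr ler_wsqrtr //.
apply: limr_le; first exact: (l2_bounded leM).
by near=> N; rewrite /series /= big_mkord.
Unshelve. all: by end_near. Qed.

Lemma coord_le_l2norm c n : l2 c -> normc (c n) <= l2norm c.
Proof.
move=> l2c; rewrite -(@ler_pXn2r _ 2) ?nnegrE ?normc_ge0 ?l2norm_ge0 //.
apply: le_trans (l2norm_partial_sum n.+1 l2c).
by rewrite big_ord_recr /= lerDr sumr_ge0 // => *; exact: sqr_ge0.
Qed.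

Lemma l2norm0_eq0 c : l2 c -> l2norm c = 0 -> c = fun=> 0.
Proof.
move=> l2c c0; apply/funext => n; apply: Normc.eq0_normc; apply/eqP.
by rewrite eq_le normc_ge0 andbT -c0 coord_le_l2norm.
Qed.

Lemma l2norm_0 : l2norm (fun=> 0 : R[i]) = 0.
Proof.
apply/eqP; rewrite eq_le l2norm_ge0 andbT; apply: l2norm_le => // N.
by rewrite big1 ?expr0n // => *; rewrite Normc.normc0 expr0n.
Qed.

Lemma l2normZ alpha c : l2 c -> l2norm (fun n => alpha * c n) = normc alpha * l2norm c.
Proof.
move=> l2c; apply/eqP.
rewrite -(@eqrXn2 _ 2) ?mulr_ge0 ?normc_ge0 ?l2norm_ge0 //; apply/eqP/complexI.
rewrite -inner_norm ?innerZl ?innerZr ?inner_norm //; try exact: l2Z.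
by rewrite mulrA mul_conj_norm -rmorphM -exprMn.
Qed.

(** Expanding the squared norm of [|d|^2 c - <c, d> d], which is nonnegative,
    gives the inequality without dividing by [|d|]. *)
Lemma cauchy_schwarz c d : l2 c -> l2 d -> normc (inner c d) <= l2norm c * l2norm d.
Proof.
move=> l2c l2d; have [d0|d0] := eqVneq (l2norm d) 0.
  rewrite (l2norm0_eq0 l2d d0) inner_conj ?inner0l //; last exact: l2_0.
  by rewrite rmorph0 Normc.normc0 mulr_ge0 ?l2norm_ge0.
have d_gt0 : 0 < l2norm d by rewrite lt_def d0 l2norm_ge0.
set z := inner c d; pose D := l2norm d ^+ 2.
pose e n := D%:C * c n - z * d n.
have l2zd := l2Z (alpha := z) l2d; have l2Dc := l2Z (alpha := D%:C) l2c.
have l2e : l2 e := l2B l2Dc l2zd.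
have := sqr_ge0 (l2norm e); rewrite -lecR -inner_norm //.
rewrite /e innerBl ?innerBr ?innerZl ?innerZr ?inner_norm // -/D -/z.
rewrite (inner_conj l2c l2d) -/z !conjE conjc_real.
have -> : D%:C * (D%:C * (l2norm c ^+ 2)%:C) - D%:C * (z^* * z) -
    (z * (D%:C * z^*) - z * (z^* * D%:C)) = D%:C * (D%:C * (l2norm c ^+ 2)%:C - z * Num.conj z).
  by rewrite !conjE; ring.
rewrite mul_conj_norm -!rmorphM -rmorphB -rmorphM lecR pmulr_rge0 ?exprn_gt0 //.
rewrite subr_ge0 /D -exprMn ler_pXn2r ?nnegrE ?mulr_ge0 ?l2norm_ge0 ?normc_ge0 //.
by rewrite mulrC.
Qed.

Lemma l2normD c d : l2 c -> l2 d -> l2norm (fun n => c n + d n) <= l2norm c + l2norm d.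
Proof.
move=> l2c l2d; have l2cd := l2D l2c l2d.
rewrite -(@ler_pXn2r _ 2) ?nnegrE ?addr_ge0 ?l2norm_ge0 //.
have -> : l2norm (fun n => c n + d n) ^+ 2 =
    l2norm c ^+ 2 + 2 * Re (inner c d) + l2norm d ^+ 2.
  apply: complexI; rewrite -inner_norm // innerDl ?innerDr ?inner_norm //.
  rewrite (inner_conj l2c l2d) conjE; case: (inner c d) => x y.
  by apply: complex_eqP => /=; ring.
have := le_trans (ler_norm _) (le_trans (abs_Re_le (inner c d)) (cauchy_schwarz l2c l2d)).
by move=> h; nra.
Qed.

Lemma l2cvg_small f c (e : R) : l2cvg f c -> 0 < e ->
  \forall k \near \oo, l2norm (fun n => f k n - c n) < e.
Proof.
move=> /cvgrPdist_lt/(_ e) + e0 => /(_ e0); apply: filterS => k.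
by rewrite sub0r normrN ger0_norm ?l2norm_ge0.
Qed.

(** Identities between inner products with fixed vectors pass to the limit, by
    the Cauchy-Schwarz inequality. *)
Lemma l2cvg_inner (f g : nat -> nat -> R[i]) c d (e : nat -> R[i]) w :
  (forall k : nat, l2 (f k)) -> (forall k : nat, l2 (g k)) ->
  l2 c -> l2 d -> l2 e -> l2 w -> l2cvg f c -> l2cvg g d ->
  (forall k, inner (f k) e = inner (g k) w) -> inner c e = inner d w.
Proof.
move=> l2f l2g l2c l2d l2e l2w fc gd fg.
apply/eqP; rewrite -subr_eq0; apply/eqP/Normc.eq0_normc/eqP.
rewrite eq_le normc_ge0 andbT; apply/ler_addgt0Pl => eps eps0; rewrite addr0.
pose M := l2norm e + l2norm w + 1.
have M0 : 0 < M by rewrite ltr_wpDl ?addr_ge0 ?l2norm_ge0.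
have eM0 : 0 < eps / M by rewrite divr_gt0.
near \oo => k.
have hf : l2norm (fun n => f k n - c n) < eps / M by near: k; exact: l2cvg_small.
have hg : l2norm (fun n => g k n - d n) < eps / M by near: k; exact: l2cvg_small.
have -> : inner c e - inner d w =
    inner (fun n => g k n - d n) w - inner (fun n => f k n - c n) e.
  by rewrite !innerBl // fg; ring.
apply: le_trans (normcB _ _) _.
apply: le_trans (lerD (cauchy_schwarz (l2B (l2g k) l2d) l2w)
                      (cauchy_schwarz (l2B (l2f k) l2c) l2e)) _.
have := l2norm_ge0 e; have := l2norm_ge0 w; move: hf hg => /ltW hf /ltW hg w0 e0.
apply: le_trans (lerD (ler_wpM2r w0 hg) (ler_wpM2r e0 hf)) _.
rewrite -mulrDr -[leRHS](divfK (lt0r_neq0 M0)) ler_pM2l //.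
by rewrite /M; lra.
Unshelve. all: by end_near. Qed.

Lemma inner0r c : l2 c -> inner c (fun=> 0) = 0.
Proof. by move=> l2c; rewrite inner_conj ?inner0l ?rmorph0 //; exact: l2_0. Qed.


Lemma l2cvg_le (f g : nat -> nat -> R[i]) c d (M : R) :
  (forall k, l2norm (fun n => g k n - d n) <= M * l2norm (fun n => f k n - c n)) ->
  l2cvg f c -> l2cvg g d.
Proof.
move=> le_gf fc; apply: (@squeeze_cvgr _ _ _ _ (fun=> 0) (fun k => M * l2norm (f k \- c))).
- by near=> k; rewrite l2norm_ge0 le_gf.
- exact: cvg_cst.
- by rewrite -(mulr0 M); exact: cvgMl_tmp.
Unshelve. all: by end_near. Qed.


End L2Space.

(** * Finitely supported sequences *)

Section FiniteSupport.
Variable R : realType.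
Implicit Types (c d f w : nat -> R[i]).
Local Notation normc := (@Normc.normc R).

Lemma has_csum_finsupp (u : nat -> R[i]) N : (forall n, (N <= n)%N -> u n = 0) ->
  has_csum u (\sum_(n < N) u n).
Proof.
move=> u0.
have ser (n : nat) : (N <= n)%N -> series (u : nat -> R[i]^o) n = \sum_(n < N) u n.
  move=> leNn; rewrite -(big_mkord xpredT u) /series /= (big_cat_nat (leq0n N) leNn) //=.
  rewrite [X in _ + X]big_nat_cond [X in _ + X]big1 ?addr0 // => k.
  by rewrite andbT => /andP[Nk _]; exact: u0.
split; apply: cvg_near_cst; exists N => // n /= Nn.
  by rewrite -series_Re ser.
by rewrite -series_Im ser.
Qed.

Lemma inner_finsuppl c d N : (forall n, (N <= n)%N -> c n = 0) ->
  inner c d = \sum_(n < N) c n * Num.conj (d n).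
Proof.
move=> c0; apply: has_csum_csum.
by apply: (@has_csum_finsupp (fun n => c n * Num.conj (d n))) => n Nn; rewrite c0 // mul0r.
Qed.

Definition unit_seq (k : nat) : nat -> R[i] := fun n => (n == k)%:R.

Lemma unit_seq_finsupp k : finsupp (unit_seq k).
Proof. by exists k.+1 => n kn; rewrite /unit_seq gtn_eqF. Qed.

Lemma inner_unitl k d : inner (unit_seq k) d = Num.conj (d k).
Proof.
rewrite (@inner_finsuppl _ _ k.+1); last by move=> n kn; rewrite /unit_seq gtn_eqF.
rewrite big_ord_recr /= /unit_seq eqxx mul1r big1 ?add0r // => i _.
by rewrite ltn_eqF // mul0r.
Qed.

Lemma inner_unitr k c : l2 c -> inner c (unit_seq k) = c k.
Proof.
move=> l2c; rewrite inner_conj ?inner_unitl ?conjCK //.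
exact: finsupp_l2 (unit_seq_finsupp k).
Qed.

Definition truncate (N : nat) c : nat -> R[i] := fun n => if (n < N)%N then c n else 0.

Lemma truncate_finsupp N c : finsupp (truncate N c).
Proof. by exists N => n Nn; rewrite /truncate ltnNge Nn. Qed.

Lemma l2norm_truncate N c : l2 c -> l2norm (truncate N c) <= l2norm c.
Proof.
move=> l2c; apply: l2norm_le => [|M]; first exact: l2norm_ge0.
apply: le_trans (l2norm_partial_sum M l2c); apply: ler_sum => n _.
rewrite /truncate; case: ifP => // _.
by rewrite Normc.normc0 expr0n sqr_ge0.
Qed.

Lemma l2_conj c : l2 c -> l2 (fun n => Num.conj (c n)).
Proof. by rewrite /l2 /=; under [X in _ -> cvgn (series X)]eq_fun do rewrite normc_conj. Qed.

Lemma l2norm_conj c : l2norm (fun n => Num.conj (c n)) = l2norm c.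
Proof. by rewrite /l2norm; under eq_fun do rewrite normc_conj. Qed.

Lemma normc_partial_sum_le c d N : l2 c -> l2 d ->
  normc (\sum_(n < N) c n * d n) <= l2norm c * l2norm d.
Proof.
move=> l2c l2d.
have -> : \sum_(n < N) c n * d n = inner (truncate N c) (fun n => Num.conj (d n)).
  rewrite (@inner_finsuppl _ _ N); last by move=> n Nn; rewrite /truncate ltnNge Nn.
  by apply: eq_bigr => n _; rewrite /truncate ltn_ord conjCK.
apply: le_trans (cauchy_schwarz (finsupp_l2 (truncate_finsupp N c)) (l2_conj l2d)) _.
by rewrite l2norm_conj ler_wpM2r ?l2norm_ge0 ?l2norm_truncate.
Qed.

Lemma sum_real_inner f (r : nat -> R[i]) N : (forall n, Num.conj (r n) = r n) ->
  \sum_(j < N) r j * f j = inner (truncate N f) r.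
Proof.
move=> rr; rewrite (@inner_finsuppl _ _ N); last by move=> n Nn; rewrite /truncate ltnNge Nn.
by apply: eq_bigr => j _; rewrite rr /truncate ltn_ord mulrC.
Qed.


Lemma l2cvg_truncate c : l2 c -> l2cvg (truncate^~ c) c.
Proof.
move=> l2c; apply/cvgrPdist_le => e e0.
have e20 : 0 < e ^+ 2 by rewrite exprn_gt0.
move/cvgrPdist_le/(_ _ e20) : (l2c) => [N _ hN].
exists N => // M /= NM.
rewrite sub0r normrN ger0_norm ?l2norm_ge0 //.
apply: l2norm_le => [|K]; first exact: ltW.
apply: le_trans (hN M NM).
set S := limn _; rewrite ger0_norm; last first.
  rewrite subr_ge0; apply: (nondecreasing_cvgn_le _ l2c M).
  by apply: nondecreasing_series => n _ _; exact: sqr_ge0.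
rewrite lerBrDr -(big_mkord xpredT (fun n => normc (truncate M c n - c n) ^+ 2)).
pose L := maxn K M.
apply: le_trans (_ : series (fun n => normc (c n) ^+ 2) L <= S); last first.
  apply: (nondecreasing_cvgn_le _ l2c L).
  by apply: nondecreasing_series => n _ _; exact: sqr_ge0.
rewrite /series /= (big_cat_nat (leq0n M) (leq_maxr K M)) //=. rewrite [leLHS]addrC lerD2l.
apply: le_trans (_ : \sum_(0 <= n < L) normc (truncate M c n - c n) ^+ 2 <= _).
  rewrite [leRHS](big_cat_nat (leq0n K) (leq_maxl K M)) //= lerDl.
  by apply: sumr_ge0 => n _; exact: sqr_ge0.
rewrite (big_cat_nat (leq0n M) (leq_maxr K M)) //=.
rewrite big_nat big1 ?add0r; last first.
  by move=> n /andP[_ nM]; rewrite /truncate nM subrr Normc.normc0 expr0n.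
rewrite !big_nat; apply: ler_sum => n /andP[Mn _].
by rewrite /truncate ltnNge Mn /= sub0r normcN.
Qed.

End FiniteSupport.

(** * The Jacobi matrix and its boundary form *)

Section JacobiMatrix.
Variables (R : realType) (a b : nat -> R).
Hypothesis a_gt0 : forall n, 0 < a n.
Implicit Types (c d f w : nat -> R[i]) (z alpha : R[i]).
Local Notation normc := (@Normc.normc R).
Local Notation J := (jacobi a b).

Lemma aC_neq0 n : (a n)%:C != 0.
Proof. by rewrite -(rmorph0 (real_complex R)) (inj_eq (@complexI R)) gt_eqF. Qed.

Lemma jacobi_lin alpha c d : J (fun n => alpha * c n + d n) =
  fun n => alpha * J c n + J d n.
Proof. by apply/funext => -[|n]; rewrite /jacobi; ring. Qed.

Lemma jacobi_conj c : J (fun n => Num.conj (c n)) = fun n => Num.conj (J c n).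
Proof.
by apply/funext => -[|n]; rewrite /jacobi !rmorphD !rmorphM ?rmorph0 /= !conjE !conjc_real.
Qed.

Lemma jacobi_finsupp f : finsupp f -> finsupp (J f).
Proof.
move=> [N f0]; exists N.+1 => -[//|n] Nn; rewrite /jacobi !f0 ?mulr0 ?addr0 //; lia.
Qed.

(** As [a n != 0], row [n] of the equation expresses entry [n.+1] by the entries
    before it. *)
Lemma jacobi_solution_unique z f c d :
  (forall n, J c n = z * c n + f n) -> (forall n, J d n = z * d n + f n) ->
  c 0%N = d 0%N -> c = d.
Proof.
move=> Jc Jd cd0; apply/funext => n.
suff [] : c n = d n /\ c n.+1 = d n.+1 by [].
elim: n => [|n [IH IHS]]; split=> //.
  apply: (mulfI (aC_neq0 0)).
  by have := Jc 0%N; have := Jd 0%N; rewrite /jacobi cd0 !add0r => <- /addrI.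
apply: (mulfI (aC_neq0 n.+1)).
by have := Jc n.+1; have := Jd n.+1; rewrite /jacobi IH IHS => <- /addrI.
Qed.

(** Summation by parts; only the boundary term at [N] survives. *)
Lemma lagrange_identity f w N :
  \sum_(n < N.+1) (J f n * Num.conj (w n) - f n * Num.conj (J w n)) =
  (a N)%:C * (f N.+1 * Num.conj (w N) - f N * Num.conj (w N.+1)).
Proof.
have conjJ n : Num.conj (J w n) = J (fun n => Num.conj (w n)) n.
  by rewrite jacobi_conj.
elim: N => [|N IH]; first by rewrite big_ord1 conjJ /jacobi; ring.
by rewrite big_ord_recr /= IH conjJ /jacobi; ring.
Qed.

Lemma jacobi_sym_finsupp f w : finsupp f -> inner (J f) w = inner f (J w).
Proof.
move=> [N f0].
rewrite (@inner_finsuppl _ _ _ N.+1); last first.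
  by move=> -[//|n] Nn; rewrite /jacobi !f0 ?mulr0 ?addr0 //; lia.
rewrite (@inner_finsuppl _ f _ N.+1); last by move=> n Nn; rewrite f0 //; lia.
apply/eqP; rewrite -subr_eq0 -sumrB lagrange_identity !f0 //.
by rewrite !mul0r subrr mulr0.
Qed.

Definition boundary_form c w : R[i] := inner (J c) w - inner c (J w).

(** The domain of [T^*]. *)
Definition max_dom c := l2 c /\ l2 (J c).

Lemma boundary_form_lin alpha c d w : max_dom c -> max_dom d -> max_dom w ->
  boundary_form (fun n => alpha * c n + d n) w =
  alpha * boundary_form c w + boundary_form d w.
Proof.
move=> [l2c l2Jc] [l2d l2Jd] [l2w l2Jw].
by rewrite /boundary_form jacobi_lin !inner_linl //; ring.
Qed.

Lemma boundary_form_linr alpha c d w : max_dom c -> max_dom d -> max_dom w ->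
  boundary_form w (fun n => alpha * c n + d n) = Num.conj alpha * boundary_form w c + boundary_form w d.
Proof.
move=> [l2c l2Jc] [l2d l2Jd] [l2w l2Jw].
by rewrite /boundary_form jacobi_lin !inner_linr //; ring.
Qed.


Lemma boundary_form_conj c w : max_dom c -> max_dom w ->
  boundary_form w c = - Num.conj (boundary_form c w).
Proof.
move=> [l2c l2Jc] [l2w l2Jw].
rewrite /boundary_form (inner_conj l2Jc l2w) (inner_conj l2c l2Jw) rmorphB /=.
by ring.
Qed.

Lemma max_dom_lin alpha c d : max_dom c -> max_dom d ->
  max_dom (fun n => alpha * c n + d n).
Proof. by move=> [c1 c2] [d1 d2]; rewrite /max_dom jacobi_lin; split; exact: l2_lin. Qed.

(** The closure of [J] on finite sequences acts by [J]: testing the limit of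
    [J (f k)] against [e_n] identifies its entries. *)
Lemma dom_T_max_dom c : dom_T a b c ->
  max_dom c /\ forall w, max_dom w -> boundary_form c w = 0.
Proof.
move=> [l2c [d [l2d [f [finf fc Jfd]]]]].
have l2f k : l2 (f k) := finsupp_l2 (finf k).
have l2Jf k : l2 (J (f k)) := finsupp_l2 (jacobi_finsupp (finf k)).
have limd w : l2 w -> l2 (J w) -> inner d w = inner c (J w).
  move=> l2w l2Jw; apply: (l2cvg_inner l2Jf l2f) Jfd fc _ => // k.
  exact: jacobi_sym_finsupp.
have dJc : J c = d.
  apply/funext => n; rewrite -(inner_unitr n l2d).
  have finJe := jacobi_finsupp (unit_seq_finsupp R n).
  rewrite limd; [|exact: finsupp_l2 (unit_seq_finsupp R n)|exact: finsupp_l2].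
  rewrite inner_conj ?jacobi_sym_finsupp ?inner_unitl ?conjCK //.
  - exact: unit_seq_finsupp.
  - exact: finsupp_l2.
split=> [|w [l2w l2Jw]]; first by rewrite /max_dom dJc.
by rewrite /boundary_form dJc limd ?subrr.
Qed.

Lemma finsupp_dom_T f : finsupp f -> dom_T a b f.
Proof.
move=> finf; split; first exact: finsupp_l2.
have cst g : l2cvg (fun=> g) g.
  rewrite /l2cvg (_ : (fun _ : nat => _) = fun=> 0); first exact: cvg_cst.
  apply/funext => k; apply/eqP; rewrite eq_le l2norm_ge0 andbT.
  apply: l2norm_le => // N; rewrite big1 ?expr0n // => n _.
  by rewrite /= subrr Normc.normc0 expr0n.
exists (J f); split; first exact: finsupp_l2 (jacobi_finsupp finf).
by exists (fun=> f); split.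
Qed.

End JacobiMatrix.

(** * Variation of constants *)

Section VariationOfConstants.
Variables (R : realType) (a b : nat -> R) (z : R[i]) (p q : nat -> R[i]).
Hypothesis a_gt0 : forall n, 0 < a n.
Local Notation normc := (@Normc.normc R).
Local Notation J := (jacobi a b).
Hypothesis Jp : forall n, J p n = z * p n.
Hypothesis p0 : p 0%N = 1.
Hypothesis Jq : forall n, J q n = z * q n + unit_seq R 0 n.
Hypothesis q0 : q 0%N = 0.
Implicit Types (c f : nat -> R[i]).

(** The Wronskian of two solutions is constant; here it is 1. *)
Lemma wronskian n : (a n)%:C * (q n.+1 * p n - p n.+1 * q n) = 1.
Proof.
elim: n => [|n IH].
  have := Jq 0; rewrite /jacobi /unit_seq q0 p0 !mulr0 !add0r mulr1 subr0.
  exact.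
have Hp : (a n.+1)%:C * p n.+2 = z * p n.+1 - (a n)%:C * p n - (b n.+1)%:C * p n.+1.
  by rewrite -Jp /jacobi; ring.
have Hq : (a n.+1)%:C * q n.+2 = z * q n.+1 - (a n)%:C * q n - (b n.+1)%:C * q n.+1.
  have := Jq n.+1; rewrite /unit_seq /= addr0 => <-.
  by rewrite /jacobi; ring.
rewrite mulrBr !mulrA Hp Hq -[RHS]IH.
by ring.
Qed.

(** Variation of constants: the kernel [q_n p_j - p_n q_j], [j < n], solves
    [J h = z h + f] with [h 0 = 0]. *)
Definition green f : nat -> R[i] := fun n =>
  q n * (\sum_(j < n) p j * f j) - p n * (\sum_(j < n) q j * f j).

Lemma green0 f : green f 0%N = 0.
Proof. by rewrite /green !big_ord0 !mulr0 subrr. Qed.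

Lemma jacobi_green f n : J (green f) n = z * green f n + f n.
Proof.
case: n => [|n].
  rewrite /jacobi green0 !mulr0 !add0r /green !big_ord1 p0 q0 mul0r !mulr0 subr0 mul1r.
  by have := wronskian 0; rewrite p0 q0 !mulr1 mulr0 subr0 => w; rewrite mulrA w mul1r.
rewrite /jacobi /green !big_ord_recr /=.
set P := \sum_(j < n) _; set Q := \sum_(j < n) _.
have Hp : (a n.+1)%:C * p n.+2 = z * p n.+1 - (a n)%:C * p n - (b n.+1)%:C * p n.+1.
  by rewrite -Jp /jacobi; ring.
have Hq : (a n.+1)%:C * q n.+2 = z * q n.+1 - (a n)%:C * q n - (b n.+1)%:C * q n.+1.
  have := Jq n.+1; rewrite /unit_seq /= addr0 => <-.
  by rewrite /jacobi; ring.
transitivity ((a n)%:C * (q n * P - p n * Q) +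
  (b n.+1)%:C * (q n.+1 * (P + p n * f n) - p n.+1 * (Q + q n * f n)) +
  (((a n.+1)%:C * q n.+2) * (P + p n * f n) - ((a n.+1)%:C * p n.+2) * (Q + q n * f n)) +
  (a n.+1)%:C * (q n.+2 * p n.+1 - p n.+2 * q n.+1) * f n.+1).
  by ring.
rewrite (wronskian n.+1) mul1r Hp Hq.
by ring.
Qed.

Lemma variation_of_constants c f : (forall n, J c n = z * c n + f n) ->
  c = fun n => c 0%N * p n + green f n.
Proof.
move=> Jc; apply: (jacobi_solution_unique a_gt0 Jc) => [n|].
  by rewrite jacobi_lin Jp jacobi_green; ring.
by rewrite green0 p0 mulr1 addr0.
Qed.

Hypothesis (l2p : l2 p) (l2q : l2 q).

Definition green_bound := 2 * l2norm p * l2norm q.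

Lemma green_bound_ge0 : 0 <= green_bound.
Proof. by rewrite /green_bound !mulr_ge0 ?l2norm_ge0. Qed.

Lemma green_sum_le f N : l2 f ->
  \sum_(n < N) normc (green f n) ^+ 2 <= (green_bound * l2norm f) ^+ 2.
Proof.
move=> l2f; pose F := l2norm f; pose P := l2norm p; pose Q := l2norm q.
have F0 : 0 <= F := l2norm_ge0 f.
have P0 : 0 <= P := l2norm_ge0 p.
have Q0 : 0 <= Q := l2norm_ge0 q.
have term n : normc (green f n) ^+ 2 <=
    2 * (P * F) ^+ 2 * normc (q n) ^+ 2 + 2 * (Q * F) ^+ 2 * normc (p n) ^+ 2.
  rewrite /green -mulrN; apply: le_trans (sq_normcD_le _ _) _.
  have aux (x y t : R) : 0 <= x -> x <= y -> 2 * (t * x) ^+ 2 <= 2 * y ^+ 2 * t ^+ 2.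
    move=> x0 xy; have xy2 : x ^+ 2 <= y ^+ 2 by rewrite lerXn2r ?nnegrE ?(le_trans x0).
    by rewrite exprMn; have := ler_wpM2l (sqr_ge0 t) xy2; lra.
  by rewrite !Normc.normcM normcN; apply: lerD; apply: aux;
    rewrite ?normc_ge0 ?normc_partial_sum_le.
apply: (@le_trans _ _ (\sum_(n < N) (2 * (P * F) ^+ 2 * normc (q n) ^+ 2 +
    2 * (Q * F) ^+ 2 * normc (p n) ^+ 2))); first exact: ler_sum.
rewrite big_split /= -!mulr_sumr.
have hp := l2norm_partial_sum N l2p; have hq := l2norm_partial_sum N l2q.
apply: le_trans (lerD (ler_wpM2l _ hq) (ler_wpM2l _ hp)) _; rewrite ?mulr_ge0 ?sqr_ge0 //.
by rewrite -/P -/Q -/F /green_bound -/P -/Q -/F; rewrite le_eqVlt; apply/orP; left; apply/eqP; ring.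
Qed.

Lemma green_l2 f : l2 f -> l2 (green f).
Proof. by move=> l2f; apply: l2_bounded => N; exact: green_sum_le. Qed.

Lemma l2norm_green f : l2 f -> l2norm (green f) <= green_bound * l2norm f.
Proof.
move=> l2f; apply: l2norm_le => [|N]; last exact: green_sum_le.
by rewrite mulr_ge0 ?green_bound_ge0 ?l2norm_ge0.
Qed.

Lemma p_max_dom : max_dom a b p.
Proof.
split=> //; rewrite (_ : J p = fun n => z * p n); first exact: l2Z.
by apply/funext.
Qed.

Lemma q_max_dom : max_dom a b q.
Proof.
split=> //; rewrite (_ : J q = fun n => z * q n + unit_seq R 0 n).
  exact: l2_lin l2q (finsupp_l2 (unit_seq_finsupp R 0)).
exact/funext.
Qed.

Lemma green_max_dom f : l2 f -> max_dom a b (green f).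
Proof.
move=> l2f; split; first exact: green_l2.
rewrite (_ : J _ = fun n => z * green f n + f n); first exact: l2_lin (green_l2 l2f) l2f.
exact/funext/jacobi_green.
Qed.

(** Discrete Gronwall estimate: the partial sums [C + rho sum_{j<n} A_j |c_j|]
    grow by a factor at most [1 + rho A_n^2 <= exp (rho A_n^2)], so they stay
    bounded and [c] is dominated by a multiple of [A = |p| + |q|]. *)
Lemma l2_change_parameter (w gamma : R[i]) c :
  (forall n, J c n = w * c n + gamma * unit_seq R 0 n) -> l2 c.
Proof.
move=> Jc; pose A n := normc (p n) + normc (q n).
pose rho := normc (w - z); pose C := normc (c 0%N) + normc gamma.
have A0 n : 0 <= A n by rewrite addr_ge0 ?normc_ge0.
have rho0 : 0 <= rho := normc_ge0 _.
have C0 : 0 <= C by rewrite addr_ge0 ?normc_ge0.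
pose S n := C + rho * \sum_(j < n) A j * normc (c j).
have S0 n : 0 <= S n.
  rewrite addr_ge0 // mulr_ge0 // sumr_ge0 // => j _.
  by rewrite mulr_ge0 ?normc_ge0.
pose f n := (w - z) * c n + gamma * unit_seq R 0 n.
have cE : forall n, c n = c 0%N * p n + green f n.
  move=> n; rewrite {1}(@variation_of_constants c f) // => k.
  by rewrite Jc /f; ring.
have c_le n : normc (c n) <= A n * S n.
  have psum (r : nat -> R[i]) : (forall j, normc (r j) <= A j) -> r 0%N = 0 \/ r 0%N = 1 ->
      normc (\sum_(j < n) r j * f j) <= normc gamma + rho * \sum_(j < n) A j * normc (c j).
    move=> rA r01; rewrite (_ : \sum_(j < n) _ =
      \sum_(j < n) r j * (gamma * unit_seq R 0 j) + (w - z) * \sum_(j < n) r j * c j); last first.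
      rewrite mulr_sumr -big_split /=; apply: eq_bigr => j _.
      by rewrite /f; ring.
    apply: le_trans (normcD _ _) _; apply: lerD; last first.
      rewrite Normc.normcM ler_wpM2l ?normc_ge0 //.
      apply: le_trans (normc_sum (fun j => r j * c j) n) _; apply: ler_sum => j _.
      by rewrite Normc.normcM ler_wpM2r ?normc_ge0.
    case: n => [|n]; first by rewrite big_ord0 Normc.normc0 normc_ge0.
    rewrite big_ord_recl big1 ?addr0 => [|j _]; last by rewrite /unit_seq !mulr0.
    rewrite /unit_seq eqxx mulr1.
    by case: r01 => ->; rewrite ?mul0r ?mul1r ?Normc.normc0 ?normc_ge0.
  have pA j : normc (p j) <= A j by rewrite /A lerDl normc_ge0.
  have qA j : normc (q j) <= A j by rewrite /A lerDr normc_ge0.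
  rewrite cE /green.
  apply: le_trans (normcD _ _) _.
  apply: le_trans (lerD (lexx _) (normcB _ _)) _; rewrite !Normc.normcM.
  have hp := ler_wpM2l (normc_ge0 (q n)) (psum p pA (or_intror p0)).
  have hq := ler_wpM2l (normc_ge0 (p n)) (psum q qA (or_introl q0)).
  apply: le_trans (lerD (lexx _) (lerD hp hq)) _.
  rewrite -subr_ge0 (_ : _ - _ = normc (c 0%N) * normc (q n)); last first.
    by rewrite /S /C; set T := \sum_(j < n) _; rewrite /A; ring.
  by rewrite mulr_ge0 ?normc_ge0.
pose B := rho * (2 * l2norm p ^+ 2 + 2 * l2norm q ^+ 2).
have A_sum n : \sum_(j < n) A j ^+ 2 <= 2 * l2norm p ^+ 2 + 2 * l2norm q ^+ 2.
  apply: (@le_trans _ _ (\sum_(j < n) (2 * normc (p j) ^+ 2 + 2 * normc (q j) ^+ 2))).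
    apply: ler_sum => j _; rewrite /A.
    have := sqr_ge0 (normc (p j) - normc (q j)); nra.
  by rewrite big_split /= -!mulr_sumr lerD // ler_pM2l // l2norm_partial_sum.
have S_le n : S n <= C * expR (rho * \sum_(j < n) A j ^+ 2).
  elim: n => [|n IH]; first by rewrite /S !big_ord0 !mulr0 addr0 expR0 mulr1.
  rewrite big_ord_recr /= mulrDr expRD mulrA.
  apply: (@le_trans _ _ (S n * (1 + rho * A n ^+ 2))).
    rewrite /S big_ord_recr /= -/(S n).
    have := ler_wpM2l (mulr_ge0 rho0 (A0 n)) (c_le n).
    rewrite /S => h; rewrite -subr_ge0; move: h; rewrite -subr_ge0; congr (0 <= _).
    by ring.
  apply: ler_pM => //; last exact: expR_ge1Dx.
  by rewrite addr_ge0 // mulr_ge0 // sqr_ge0.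
pose M := C * expR B.
have S_M n : S n <= M.
  apply: le_trans (S_le n) _; rewrite ler_wpM2l // ler_expR.
  by rewrite /B ler_wpM2l.
have M0 : 0 <= M by rewrite mulr_ge0 // expR_ge0.
apply: (@l2_bounded _ _ ((2 * l2norm p ^+ 2 + 2 * l2norm q ^+ 2) * M ^+ 2)) => N.
apply: (@le_trans _ _ (\sum_(n < N) A n ^+ 2 * M ^+ 2)); last first.
  by rewrite -mulr_suml ler_wpM2r ?sqr_ge0.
apply: ler_sum => n _; rewrite -exprMn lerXn2r ?nnegrE ?normc_ge0 ?mulr_ge0 //.
by apply: le_trans (c_le n) _; rewrite ler_wpM2l.
Qed.

End VariationOfConstants.

(** * Domains of the self-adjoint extensions *)

Section SelfAdjointExtensions.
Variables (R : realType) (a b : nat -> R) (p q : nat -> R[i]).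
Hypothesis a_gt0 : forall n, 0 < a n.
Local Notation normc := (@Normc.normc R).
Local Notation J := (jacobi a b).
Local Notation bform := (boundary_form a b).
Hypothesis Jp : forall n, J p n = 0 * p n.
Hypothesis p0 : p 0%N = 1.
Hypothesis Jq : forall n, J q n = 0 * q n + unit_seq R 0 n.
Hypothesis q0 : q 0%N = 0.
Hypothesis p_real : forall n, Num.conj (p n) = p n.
Hypothesis q_real : forall n, Num.conj (q n) = q n.
Hypothesis (l2p : l2 p) (l2q : l2 q).
Implicit Types (c d f w : nat -> R[i]).

Let Jp0 : J p = fun=> 0.
Proof. by apply/funext => n; rewrite Jp mul0r. Qed.

Let Jq0 : J q = unit_seq R 0.
Proof. by apply/funext => n; rewrite Jq mul0r add0r. Qed.

Let e0_l2 : l2 (unit_seq R 0) := finsupp_l2 (unit_seq_finsupp R 0).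
Let pM : max_dom a b p := p_max_dom Jp l2p.
Let qM : max_dom a b q := q_max_dom Jq l2q.

Lemma boundary_form_p c : l2 c -> bform c p = inner (J c) p.
Proof. by move=> l2c; rewrite /boundary_form Jp0 inner0r // subr0. Qed.

Lemma boundary_form_q c : l2 c -> bform c q = inner (J c) q - c 0%N.
Proof. by move=> l2c; rewrite /boundary_form Jq0 inner_unitr. Qed.

(** [f = J c] is orthogonal to [p]; truncating it and restoring this
    orthogonality with a multiple of [e_0] gives finitely supported [g] with
    [g --> f], and the solution of [J h = g] with [h_0 = <g, q>] vanishes
    beyond the support of [g]. *)
Lemma boundary_form0_dom_T c : max_dom a b c -> bform c p = 0 -> bform c q = 0 ->
  dom_T a b c.
Proof.
move=> [l2c l2f] cp cq; split=> //; exists (J c); split=> //.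
set f := J c in l2f *.
have fp : inner f p = 0 by rewrite -boundary_form_p.
have fq : inner f q = c 0%N.
  by apply/eqP; rewrite -subr_eq0 -boundary_form_q // cq.
pose s N := \sum_(j < N.+1) p j * f j.
pose r N := \sum_(j < N.+1) q j * f j.
pose T N := truncate N.+1 f.
pose g N n := - s N * unit_seq R 0 n + T N n.
pose h N n := r N * p n + green p q (g N) n.
have Tl2 N : l2 (T N) := finsupp_l2 (truncate_finsupp N.+1 f).
have gl2 N : l2 (g N) by exact: l2_lin.
have Jh N : J (h N) = g N.
  apply/funext => n; rewrite /h jacobi_lin Jp (jacobi_green Jp p0 Jq q0).
  by rewrite !mul0r mulr0 !add0r.
have sumg N n (u : nat -> R[i]) : (N.+1 <= n)%N ->
    \sum_(j < n) u j * g N j = \sum_(j < N.+1) u j * f j - s N * u 0%N.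
  move=> Nn; rewrite -(big_mkord xpredT (fun j => u j * g N j)).
  rewrite (big_cat_nat (leq0n N.+1) Nn) /=.
  rewrite [X in _ + X]big_nat_cond [X in _ + X]big1 ?addr0; last first.
    move=> j; rewrite andbT => /andP[Nj _].
    rewrite /g /T /truncate /unit_seq ltnNge Nj /= gtn_eqF ?(leq_trans _ Nj) //.
    by rewrite mulr0 add0r mulr0.
  rewrite big_mkord big_ord_recl [in RHS]big_ord_recl.
  rewrite (eq_bigr (fun j : 'I_N => u (lift ord0 j) * f (lift ord0 j))); last first.
    by move=> j _; rewrite /g /T /truncate ltn_ord /unit_seq /= mulr0 add0r.
  by rewrite /g /T /truncate /unit_seq /=; ring.
(* As [p 0 = 1] and [q 0 = 0], subtracting [s N] times [e_0] makes the sum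
   against [p] vanish and leaves the sum against [q] unchanged. *)
have hfin N : finsupp (h N).
  exists N.+1 => n Nn; rewrite /h /green !sumg // p0 q0 -/(s N) -/(r N).
  by ring.
pose D N := l2norm (fun n => T N n - f n).
have Tf : l2cvg T f.
  rewrite /l2cvg /T.
  have : (fun k => l2norm (truncate k f \- f)) @ \oo --> (0 : R) := l2cvg_truncate l2f.
  by move=> /cvgrPdist_lt Tc; apply/cvgrPdist_lt => e /Tc[N _ hN]; exists N => // k /= Nk; apply/hN/leqW.
have s_le N : normc (s N) <= D N * l2norm p.
  rewrite /s (sum_real_inner _ _ p_real) -[X in normc X]subr0 -fp -(innerBl (Tl2 N) l2f l2p).
  by apply: cauchy_schwarz => //; exact: l2B (Tl2 N) l2f.
have r_le N : normc (r N - c 0%N) <= D N * l2norm q.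
  rewrite /r (sum_real_inner _ _ q_real) -fq -(innerBl (Tl2 N) l2f l2q).
  by apply: cauchy_schwarz => //; exact: l2B (Tl2 N) l2f.
have gf_le N : l2norm (fun n => g N n - f n) <= (l2norm p * l2norm (unit_seq R 0) + 1) * D N.
  rewrite (_ : (fun n => _) = fun n => - s N * unit_seq R 0 n + (T N n - f n)); last first.
    by apply/funext => n; rewrite /g addrA.
  apply: le_trans (l2normD (l2Z e0_l2) (l2B (Tl2 N) l2f)) _.
  rewrite l2normZ // normcN.
  have := ler_wpM2r (l2norm_ge0 (unit_seq R 0)) (s_le N); rewrite -/(D N) => H.
  by lra.
exists h; split=> //; last first.
  rewrite (_ : (fun k => _) = g); last by apply/funext.
  exact: l2cvg_le gf_le Tf.
pose K := green_bound p q.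
apply: (l2cvg_le (M := l2norm q * l2norm p + K * (l2norm p * l2norm (unit_seq R 0) + 1)) _ Tf).
move=> N; rewrite -/(D N).
rewrite (_ : (fun n => _) = fun n => (r N - c 0%N) * p n + green p q (fun n => g N n - f n) n); last first.
  have cE := @variation_of_constants _ _ _ 0 _ _ a_gt0 Jp p0 Jq q0 c f.
  apply/funext => n; rewrite {1}cE; last by move=> k; rewrite mul0r add0r.
  rewrite /h /green.
  have lin (u : nat -> R[i]) : \sum_(j < n) u j * (g N j - f j) =
      \sum_(j < n) u j * g N j - \sum_(j < n) u j * f j.
    by rewrite -sumrB; apply: eq_bigr => j _; rewrite mulrBr.
  by rewrite !lin; ring.
have gfl2 : l2 (fun n => g N n - f n) by exact: l2B.
apply: le_trans (l2normD (l2Z l2p) (green_l2 l2p l2q gfl2)) _.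
rewrite l2normZ // [leRHS]mulrDl; apply: lerD.
  by have := ler_wpM2r (l2norm_ge0 p) (r_le N); rewrite -/(D N) => H; lra.
apply: le_trans (l2norm_green l2p l2q gfl2) _.
by rewrite -mulrA ler_wpM2l ?gf_le // green_bound_ge0.
Qed.

Definition extension_vector (t : option R) : nat -> R[i] :=
  if t is Some r then fun n => q n + r%:C * p n else p.

Lemma extension_vectorE t : extension_vector t =
  if t is Some r then fun n => r%:C * p n + q n else p.
Proof. by case: t => //= r; apply/funext => n; rewrite addrC. Qed.

Lemma extension_vector_max_dom t : max_dom a b (extension_vector t).
Proof. by rewrite extension_vectorE; case: t => // r; exact: max_dom_lin. Qed.

Let bpp : bform p p = 0.
Proof. by rewrite boundary_form_p // Jp0 inner0l. Qed.
Let bpq : bform p q = -1.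
Proof. by rewrite boundary_form_q // Jp0 inner0l p0 sub0r. Qed.
Let bqp : bform q p = 1.
Proof. by rewrite boundary_form_p // Jq0 inner_unitl p0 rmorph1. Qed.
Let bqq : bform q q = 0.
Proof. by rewrite boundary_form_q // Jq0 inner_unitl q0 rmorph0 subrr. Qed.

Lemma boundary_form_extension c t : max_dom a b c ->
  bform c (extension_vector t) =
  if t is Some r then r%:C * bform c p + bform c q else bform c p.
Proof.
move=> cM; rewrite extension_vectorE; case: t => // r.
by rewrite boundary_form_linr // conjE conjc_real.
Qed.

(** Modulo [D(T)] the domain of [T^*] is spanned by [p] and [q], and the
    boundary form is nondegenerate on this plane; the line through the extension
    vector is its own annihilator, which turns membership in [D(T_t)] into one
    equation. *)
Lemma dom_TtP t c : dom_Tt a b p q t c <->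
  max_dom a b c /\ bform c (extension_vector t) = 0.
Proof.
have vM := extension_vector_max_dom t.
have vv : bform (extension_vector t) (extension_vector t) = 0.
  rewrite boundary_form_extension // !extension_vectorE; case: t {vM} => [r|//].
  by rewrite !boundary_form_lin // bpp bpq bqp bqq; ring.
split=> [[d dT [alpha ->]]|[cM cv]].
  have [dM d0] := dom_T_max_dom dT.
  rewrite -/(extension_vector t).
  rewrite (_ : (fun n => _) = fun n => alpha * extension_vector t n + d n); last first.
    by apply/funext => n; rewrite addrC.
  split; first exact: max_dom_lin.
  by rewrite boundary_form_lin // vv d0 // mulr0 addr0.
pose alpha := if t is Some _ then bform c p else - bform c q.
exists (fun n => - alpha * extension_vector t n + c n); last first.
  by exists alpha; apply/funext => n; rewrite -/(extension_vector t); ring.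
apply: boundary_form0_dom_T.
- exact: max_dom_lin.
- move: cv; rewrite boundary_form_lin // boundary_form_extension // extension_vectorE.
  rewrite /alpha; case: t {vM vv alpha} => [r|] cv; last by rewrite bpp cv; ring.
  by rewrite boundary_form_lin // bpp bqp; ring.
- move: cv; rewrite boundary_form_lin // boundary_form_extension // extension_vectorE.
  rewrite /alpha; case: t {vM vv alpha} => [r|] cv; last by rewrite bpq; ring.
  by rewrite boundary_form_lin // bpq bqq -[RHS]cv; ring.
Qed.

End SelfAdjointExtensions.

(** * Finite measures on the line *)

Section FiniteMeasuresOnTheLine.
Variable R : realType.
Implicit Types m : {measure set (measurableTypeR R) -> \bar R}.

Lemma measurable_sqr :
  measurable_fun [set: R] (EFin \o (fun x : R => x ^+ 2)).
Proof. by apply/measurable_EFinP; exact: measurable_funX. Qed.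

(** The bound [|x| <= 1 + x^2] is integrable for a finite measure. *)
Lemma integrable_id_of_sqr m : (m setT < +oo)%E -> (\int[m]_x (x ^+ 2)%:E < +oo)%E ->
  m.-integrable setT (fun x => x%:E).
Proof.
move=> mfin m2.
have abs_le (x : R) : `|x| <= 1 + x ^+ 2.
  by have [x0|x0] := ger0P x; have := sqr_ge0 (x - 1); have := sqr_ge0 (x + 1); nra.
apply/integrableP; split.
  by apply/measurable_EFinP; exact: measurable_id.
apply: (@le_lt_trans _ _ (\int[m]_x (1 + (x ^+ 2)%:E))%E).
  apply: ge0_le_integral => //=.
  - by apply/measurable_EFinP; exact: normr_measurable.
  - by apply: emeasurable_funD => //; exact: measurable_sqr.
  - move=> x _; rewrite -EFinD lee_fin.
    exact: abs_le.
rewrite ge0_integralD //=; last 2 first.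
- by move=> x _; rewrite lee_fin sqr_ge0.
- exact: measurable_sqr.
by rewrite integral_cst // mul1e lte_add_pinfty.
Qed.

Lemma ge0_integral_additive m m1 m2 (f : R -> \bar R) :
  (forall S : set (measurableTypeR R), measurable S -> m S = (m1 S + m2 S)%E) ->
  (forall x, 0 <= f x)%E -> measurable_fun setT f ->
  (\int[m]_x f x = \int[m1]_x f x + \int[m2]_x f x)%E.
Proof.
move=> mE f0 mf; rewrite -ge0_integral_measure_add //.
by apply: eq_measure_integral => A mA _; rewrite mE //; exact: esym (measure_addE _ _ _).
Qed.

Lemma Rintegral_id_additive m m1 m2 :
  (forall S : set (measurableTypeR R), measurable S -> m S = (m1 S + m2 S)%E) ->
  m1.-integrable setT (fun x => x%:E) -> m2.-integrable setT (fun x => x%:E) ->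
  (\int[m]_x x = \int[m1]_x x + \int[m2]_x x)%R.
Proof.
move=> mE i1 i2; rewrite /Rintegral -fineD; last 2 first.
- exact: integrable_fin_num.
- exact: integrable_fin_num.
rewrite -integral_measure_add //.
by congr fine; apply: eq_measure_integral => A mA _; rewrite mE //; exact: esym (measure_addE _ _ _).
Qed.

Lemma integrable_cst_fin m (B : set (measurableTypeR R)) (M : R) :
  measurable B -> (m B < +oo)%E -> m.-integrable B (EFin \o (fun=> M)).
Proof.
move=> mB mBfin; apply: measurable_bounded_integrable => //.
by exists `|M|; split; [exact: num_real|move=> r /ltW Mr x _ /=].
Qed.

Lemma measure_setT_support m (B : set (measurableTypeR R)) :
  measurable B -> m (~` B) = 0%E -> m setT = m B.
Proof.
move=> mB mBc; rewrite -(setUv B) measureU ?setICr //; last exact: measurableC.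
by rewrite [X in (_ + X)%E]mBc; exact: addr0.
Qed.

Lemma integral_sqr_bounded_support m (B : set (measurableTypeR R)) (M : R) :
  measurable B -> m (~` B) = 0%E -> (m setT < +oo)%E ->
  (forall x, B x -> x ^+ 2 <= M) -> (\int[m]_x (x ^+ 2)%:E < +oo)%E.
Proof.
move=> mB mBc mfin leM.
rewrite (ge0_negligible_integral (measurableC mB)) //; last 2 first.
- exact: measurable_sqr.
- by move=> x _; rewrite lee_fin sqr_ge0.
rewrite setTD setCK; apply: (@le_lt_trans _ _ (\int[m]_(x in B) cst M%:E x)%E).
  apply: ge0_le_integral => //=.
  - by move=> x _; rewrite lee_fin sqr_ge0.
  - by apply: measurable_funTS; exact: measurable_sqr.
rewrite integral_cst //.
have mBfin : (m B < +oo)%E.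
  by apply: le_lt_trans mfin; apply: le_measure; rewrite ?inE.
have : m B \is a fin_num by rewrite ge0_fin_numE.
by move=> /fineK <-; rewrite -EFinM ltry.
Qed.

Lemma Rintegral_id_support_le m (B : set (measurableTypeR R)) (M : R) :
  measurable B -> m (~` B) = 0%E -> (m setT < +oo)%E ->
  m.-integrable setT (fun x => x%:E) ->
  (forall x, B x -> x <= M) -> (\int[m]_x x <= M * fine (m setT))%R.
Proof.
move=> mB mBc mfin im leM.
have mBfin : (m B < +oo)%E.
  by apply: le_lt_trans mfin; apply: le_measure; rewrite ?inE.
rewrite (measure_setT_support mB mBc).
rewrite -Rintegral_cst // [leLHS]/Rintegral (negligible_integral (measurableC mB)) // setTD setCK.
apply: le_Rintegral => //.
- exact: integrableS im.
- exact: integrable_cst_fin.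
Qed.

Lemma Rintegral_id_support_ge m (B : set (measurableTypeR R)) (M : R) :
  measurable B -> m (~` B) = 0%E -> (m setT < +oo)%E ->
  m.-integrable setT (fun x => x%:E) ->
  (forall x, B x -> M <= x) -> (M * fine (m setT) <= \int[m]_x x)%R.
Proof.
move=> mB mBc mfin im leM.
have mBfin : (m B < +oo)%E.
  by apply: le_lt_trans mfin; apply: le_measure; rewrite ?inE.
rewrite (measure_setT_support mB mBc).
rewrite -Rintegral_cst // [leRHS]/Rintegral (negligible_integral (measurableC mB)) // setTD setCK.
apply: le_Rintegral => //.
- exact: integrable_cst_fin.
- exact: integrableS im.
Qed.

End FiniteMeasuresOnTheLine.

(** * Spectral measures of operators on sequences *)

Lemma shifted_form_expansion (R : realType) (agg agu auu gu : R[i]) (r x G U : R) :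
  Re (agu - x%:C * gu) = G ->
  Re (r%:C * (r%:C * agg + agu) + (r%:C * Num.conj agu + auu)) -
    x * Re (r%:C * (r%:C * G%:C + gu) + (r%:C * Num.conj gu + U%:C)) =
  r ^+ 2 * (Re agg - x * G) + (Re auu - x * U) + 2 * r * G.
Proof.
by case: agg agu auu gu => [? ?] [? ?] [? ?] [? ?] <-; rewrite !conjE /=; ring.
Qed.


Section SpectralMeasure.
Variables (R : realType) (D : set (nat -> R[i])).
Variables (A : (nat -> R[i]) -> nat -> R[i]) (E : set R -> (nat -> R[i]) -> nat -> R[i]).
Hypothesis E_spec : spectral_measure D A E.
Hypothesis D_lin : forall (alpha : R[i]) c d, D c -> D d -> D (fun n => alpha * c n + d n).
Hypothesis A_lin : forall (alpha : R[i]) c d,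
  A (fun n => alpha * c n + d n) = fun n => alpha * A c n + A d n.
Hypothesis A_l2 : forall c, D c -> l2 (A c).
Hypothesis D_unit : forall k, D (unit_seq R k).
Implicit Types (c d u v w : nat -> R[i]) (S B : set (measurableTypeR R)) (alpha : R[i]).

Let D_l2 c : D c -> l2 c. Proof. by case: E_spec => _ + _; exact. Qed.

Lemma E_l2 B c : measurable B -> l2 c -> l2 (E B c).
Proof. by case: E_spec => -[Eproj _ _] _ _ /Eproj[+ _ _ _]; exact. Qed.

Lemma E_lin B alpha c d : measurable B -> l2 c -> l2 d ->
  E B (fun n => alpha * c n + d n) = fun n => alpha * E B c n + E B d n.
Proof. by case: E_spec => -[Eproj _ _] _ _ /Eproj[_ + _ _]; exact. Qed.

Lemma E_idem B c : measurable B -> l2 c -> E B (E B c) = E B c.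
Proof. by case: E_spec => -[Eproj _ _] _ _ /Eproj[_ _ + _]; exact. Qed.

Lemma E_sym B c d : measurable B -> l2 c -> l2 d -> inner (E B c) d = inner c (E B d).
Proof. by case: E_spec => -[Eproj _ _] _ _ /Eproj[_ _ _ +]; exact. Qed.

Lemma E_setT c : l2 c -> E setT c = c.
Proof. by case: E_spec => -[_ + _] _ _; exact. Qed.

Lemma E_zero B : measurable B -> E B (fun=> 0) = fun=> 0.
Proof.
move=> mB; have l20 := @l2_0 R.
have := E_lin 1 mB l20 l20; under eq_fun do rewrite mul1r addr0.
move=> H; apply/funext => n; have := congr1 (fun f => f n) H => /=.
by rewrite mul1r => /eqP; rewrite -[X in X == _]addr0 (inj_eq (addrI _)) eq_sym => /eqP.
Qed.

Lemma E_sub B c d : measurable B -> l2 c -> l2 d ->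
  E B (fun n => c n - d n) = fun n => E B c n - E B d n.
Proof.
move=> mB l2c l2d; transitivity (E B (fun n => -1 * d n + c n)).
  by congr (E B _); apply/funext => n; rewrite mulN1r addrC.
by rewrite E_lin //; apply/funext => n; rewrite mulN1r addrC.
Qed.

Lemma inner_E B c : measurable B -> l2 c ->
  inner (E B c) c = (l2norm (E B c) ^+ 2)%:C.
Proof.
move=> mB l2c; have l2E := E_l2 mB l2c.
by rewrite -inner_norm // -[in LHS](E_idem mB l2c) E_sym.
Qed.

(** An orthogonal projection satisfies [<E B c, c> = |E B c|^2], so the measures
    attached to [E] record squared norms. *)
Lemma spectral_weight c : l2 c ->
  exists m : {measure set (measurableTypeR R) -> \bar R},
  [/\ forall B, measurable B -> m B = (l2norm (E B c) ^+ 2)%:E,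
      m setT = (l2norm c ^+ 2)%:E,
      D c <-> (\int[m]_x (x ^+ 2)%:E < +oo)%E
    & D c -> inner (A c) c = ((\int[m]_x x)%R)%:C].
Proof.
move=> l2c; case: E_spec => _ _ /(_ c l2c)[m [mE Dc Ac]]; exists m.
have mE' B : measurable B -> m B = (l2norm (E B c) ^+ 2)%:E.
  by move=> mB; rewrite mE // inner_E.
by split=> //; rewrite mE' // E_setT.
Qed.

Lemma weight_split S B c : measurable S -> measurable B -> l2 c ->
  l2norm (E S c) ^+ 2 =
  l2norm (E (S `&` B) c) ^+ 2 + l2norm (E (S `&` ~` B) c) ^+ 2.
Proof.
move=> mS mB l2c; have [m [mE _ _ _]] := spectral_weight l2c.
have mBc := measurableC mB.
have m1 : measurable (S `&` B) by exact: measurableI.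
have m2 : measurable (S `&` ~` B) by exact: measurableI.
have disj : (S `&` B) `&` (S `&` ~` B) = set0 by rewrite setIACA setICr setI0.
have : m (S `&` B `|` S `&` ~` B) = (m (S `&` B) + m (S `&` ~` B))%E.
  exact: measureU.
by rewrite -setIUr setUv setIT !mE // => -[].
Qed.

Lemma weight0_subset S B c : measurable S -> measurable B -> l2 c -> S `<=` B ->
  E B c = (fun=> 0) -> E S c = fun=> 0.
Proof.
move=> mS mB l2c SB EB0; apply: l2norm0_eq0; first exact: E_l2.
have norm0 := @l2norm_0 R.
have := weight_split mB mS l2c; rewrite EB0 norm0 setIC (setIidl SB) => /esym/eqP.
rewrite expr0n /= paddr_eq0 ?sqr_ge0 // sqrf_eq0 => /andP[/eqP -> _].
by [].
Qed.

Lemma sqnorm_E_compl B c : measurable B -> l2 c ->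
  l2norm c ^+ 2 = l2norm (E B c) ^+ 2 + l2norm (fun n => c n - E B c n) ^+ 2.
Proof.
move=> mB l2c; have l2E := E_l2 mB l2c; have l2d := l2B l2c l2E.
apply: complexI; rewrite rmorphD /= -!inner_norm // innerBl ?innerBr //.
by rewrite -(E_sym mB l2c l2c) // inner_E // !inner_norm //; ring.
Qed.

Definition in_range B c := l2 c /\ E B c = c.

Lemma in_rangeE B c : measurable B -> l2 c -> in_range B (E B c).
Proof. by move=> mB l2c; split; [exact: E_l2|exact: E_idem]. Qed.

Lemma in_range_compl0 B c : measurable B -> in_range B c -> E (~` B) c = fun=> 0.
Proof.
move=> mB [l2c Ec]; have mBc := measurableC mB.
apply: l2norm0_eq0; first exact: E_l2.
have := weight_split measurableT mB l2c; rewrite !setTI E_setT // Ec => /eqP.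
by rewrite -subr_eq0 opprD addrA subrr sub0r oppr_eq0 sqrf_eq0 => /eqP.
Qed.

Lemma compl0_in_range B c : measurable B -> l2 c -> E (~` B) c = (fun=> 0) -> in_range B c.
Proof.
move=> mB l2c Ec0; split=> //; have mBc := measurableC mB.
have norm0 := @l2norm_0 R.
have := weight_split measurableT mB l2c; rewrite !setTI E_setT // Ec0 norm0 expr0n.
rewrite (sqnorm_E_compl mB l2c) => /addrI/eqP; rewrite sqrf_eq0 => /eqP h.
have := l2norm0_eq0 (l2B l2c (E_l2 mB l2c)) h => {}h.
by apply/funext => n; have := congr1 (fun f => f n) h => /= /eqP; rewrite subr_eq0 => /eqP.
Qed.

(** Additivity of the weight of a single vector is enough to see that the
    residue of [E B] lies in the range of the complementary projection. *)
Lemma in_range_resid B c : measurable B -> l2 c ->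
  in_range (~` B) (fun n => c n - E B c n).
Proof.
move=> mB l2c; have mBc := measurableC mB; have l2E := E_l2 mB l2c.
apply: compl0_in_range => //; first exact: l2B.
by rewrite setCK E_sub // E_idem //; apply/funext => n; rewrite subrr.
Qed.

Lemma in_range_lin B alpha c d : measurable B -> in_range B c -> in_range B d ->
  in_range B (fun n => alpha * c n + d n).
Proof.
move=> mB [l2c Ec] [l2d Ed]; split; first exact: l2_lin.
by rewrite E_lin // Ec Ed.
Qed.

(** Vectors from the ranges of [E B] and [E (~` B)] have mutually singular
    spectral weights, so the weight of their sum is the sum of the weights. *)
Lemma weight_sum B alpha u v S : measurable B -> measurable S ->
  in_range B u -> in_range (~` B) v -> Normc.normc alpha = 1 ->
  l2norm (E S (fun n => alpha * v n + u n)) ^+ 2 =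
  l2norm (E S u) ^+ 2 + l2norm (E S v) ^+ 2.
Proof.
move=> mB mS uB vB alpha1; have [l2u _] := uB; have [l2v _] := vB.
have mBc := measurableC mB.
have mSB : measurable (S `&` B) by exact: measurableI.
have mSBc : measurable (S `&` ~` B) by exact: measurableI.
have vB0 : E B v = fun=> 0 by rewrite -[B]setCK; exact: in_range_compl0.
have uB0 : E (~` B) u = fun=> 0 by exact: in_range_compl0.
have v0 := weight0_subset mSB mB l2v (@subIsetr _ S B) vB0.
have u0 := weight0_subset mSBc mBc l2u (@subIsetr _ S (~` B)) uB0.
have norm0 := @l2norm_0 R.
have l2w : l2 (fun n => alpha * v n + u n) by exact: l2_lin.
rewrite (weight_split mS mB l2w) (weight_split mS mB l2u) (weight_split mS mB l2v).
rewrite !E_lin // u0 v0 norm0 expr0n /= addr0 add0r; congr (_ + _).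
  by congr (_ ^+ 2); congr l2norm; apply/funext => n; rewrite mulr0 add0r.
rewrite -[in RHS](mul1r (l2norm (E _ v))) -alpha1 -l2normZ; last exact: E_l2.
by congr (_ ^+ 2); congr l2norm; apply/funext => n; rewrite addr0.
Qed.

Lemma in_range_dom B M u : measurable B -> (forall x : R, B x -> x ^+ 2 <= M) ->
  in_range B u -> D u.
Proof.
move=> mB leM uB; have [l2u _] := uB.
have [m [mE mT Du _]] := spectral_weight l2u; apply/Du.
apply: (integral_sqr_bounded_support mB _ _ leM); last by rewrite mT ltry.
rewrite mE ?(in_range_compl0 mB uB); last exact: measurableC.
by rewrite l2norm_0 expr0n.
Qed.

Lemma in_range_E_dom B c : measurable B -> D c -> D (E B c).
Proof.
move=> mB Dc; have l2c := D_l2 Dc; have mBc := measurableC mB.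
have uB := in_rangeE mB l2c; have vB := in_range_resid mB l2c.
have [m [mE _ Dm _]] := spectral_weight l2c.
have [m1 [m1E _ Dm1 _]] := spectral_weight uB.1.
have [m2 [m2E _ _ _]] := spectral_weight vB.1.
apply/Dm1; apply: le_lt_trans (Dm.1 Dc).
rewrite (@ge0_integral_additive _ m m1 m2 (fun x => (x ^+ 2)%:E)).
- by rewrite leeDl // integral_ge0 // => x _; rewrite lee_fin sqr_ge0.
- move=> S mS; rewrite mE // m1E // m2E // -EFinD; congr (_%:E).
  rewrite -(weight_sum mB mS uB vB (Normc.normc1 R)); congr (l2norm (E S _) ^+ 2).
  by apply/funext => n; rewrite mul1r subrK.
- by move=> x; rewrite lee_fin sqr_ge0.
- exact: measurable_sqr.
Qed.

Lemma D_resid B c : measurable B -> D c -> D (fun n => c n - E B c n).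
Proof.
move=> mB Dc; rewrite (_ : (fun n => _) = fun n => -1 * E B c n + c n).
  by apply: D_lin => //; exact: in_range_E_dom.
by apply/funext => n; rewrite mulN1r addrC.
Qed.

Lemma inner_A_sum B alpha u v : measurable B -> in_range B u -> in_range (~` B) v ->
  D u -> D v -> Normc.normc alpha = 1 ->
  let w := fun n => alpha * v n + u n in
  inner (A w) w = inner (A u) u + inner (A v) v.
Proof.
move=> mB uB vB Du Dv alpha1 w; have Dw : D w by exact: D_lin.
have [m [mE _ _ /(_ Dw)->]] := spectral_weight (D_l2 Dw).
have [m1 [m1E m1T Dm1 /(_ Du)->]] := spectral_weight uB.1.
have [m2 [m2E m2T Dm2 /(_ Dv)->]] := spectral_weight vB.1.
rewrite -rmorphD /=; congr (_%:C); apply: Rintegral_id_additive.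
- move=> S mS; rewrite mE // m1E // m2E // -EFinD; congr (_%:E).
  exact: weight_sum mB mS uB vB alpha1.
- by apply: integrable_id_of_sqr; [rewrite m1T ltry|exact/Dm1].
- by apply: integrable_id_of_sqr; [rewrite m2T ltry|exact/Dm2].
Qed.

(** Comparing the quadratic form at [u + v] and at [u + i v] isolates the
    cross term [<A u, v>]. *)
Lemma inner_A_orthogonal B u v : measurable B -> in_range B u -> in_range (~` B) v ->
  D u -> D v -> inner (A u) v = 0.
Proof.
move=> mB uB vB Du Dv.
have [l2u l2v] := (uB.1, vB.1); have [l2Au l2Av] := (A_l2 Du, A_l2 Dv).
have cross alpha : Normc.normc alpha = 1 ->
    alpha * inner (A v) u + Num.conj alpha * inner (A u) v = 0.
  move=> alpha1; have := inner_A_sum mB uB vB Du Dv alpha1.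
  rewrite /= A_lin inner_linl ?inner_linr //; last exact: l2_lin.
  rewrite mulrDr mulrA mul_conj_norm alpha1 expr1n mul1r => /eqP.
  rewrite -subr_eq0 => /eqP H; rewrite -[RHS]H; ring.
have h1 := cross 1 (Normc.normc1 R).
have normi : Normc.normc (0 +i* 1 : R[i]) = 1.
  by rewrite /= expr0n expr1n add0r sqrtr1.
have hi := cross _ normi.
move: h1 hi; rewrite rmorph1 !mul1r conjE.
case: (inner (A v) u) (inner (A u) v) => [x y] [x' y'] [h1 h2] [].
rewrite !mul0r !mul1r ?mulN1r ?add0r => h3 h4.
by apply: complex_eqP => /=; lra.
Qed.

(** The projected unit vectors are total in the range of the complementary
    projection, and [A u] is orthogonal to them. *)
Lemma A_in_range B u : measurable B -> in_range B u -> D u -> in_range B (A u).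
Proof.
move=> mB uB Du; have mBc := measurableC mB; have l2Au := A_l2 Du.
apply: compl0_in_range => //; apply/funext => k.
rewrite -(inner_unitr k (E_l2 mBc l2Au)) E_sym //; last exact: finsupp_l2 (unit_seq_finsupp R k).
apply: inner_A_orthogonal mB uB _ Du _; last exact: in_range_E_dom.
by apply: in_rangeE => //; exact: finsupp_l2 (unit_seq_finsupp R k).
Qed.

(** The weight of a vector in the range of [E B] is carried by [B], where the
    integrand [x] is at most [M]. *)
Lemma inner_A_le B (M : R) u : measurable B -> in_range B u -> D u ->
  (forall x : R, B x -> x <= M) -> Re (inner (A u) u) <= M * l2norm u ^+ 2.
Proof.
move=> mB uB Du leM; have mBc := measurableC mB.
have [m [mE mT Dm /(_ Du)->]] := spectral_weight uB.1.
have mfin : (m setT < +oo)%E by rewrite mT ltry.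
have mB0 : m (~` B) = 0%E by rewrite mE // (in_range_compl0 mB uB) l2norm_0 expr0n.
have := Rintegral_id_support_le mB mB0 mfin _ leM; rewrite mT /=; apply.
by apply: integrable_id_of_sqr => //; exact/Dm.
Qed.

Lemma inner_A_ge B (M : R) u : measurable B -> in_range B u -> D u ->
  (forall x : R, B x -> M <= x) -> M * l2norm u ^+ 2 <= Re (inner (A u) u).
Proof.
move=> mB uB Du leM; have mBc := measurableC mB.
have [m [mE mT Dm /(_ Du)->]] := spectral_weight uB.1.
have mfin : (m setT < +oo)%E by rewrite mT ltry.
have mB0 : m (~` B) = 0%E by rewrite mE // (in_range_compl0 mB uB) l2norm_0 expr0n.
have := Rintegral_id_support_ge mB mB0 mfin _ leM; rewrite mT /=; apply.
by apply: integrable_id_of_sqr => //; exact/Dm.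
Qed.

Lemma inner_A_real u : D u -> Im (inner (A u) u) = 0.
Proof. by move=> Du; have [m [_ _ _ /(_ Du)->]] := spectral_weight (D_l2 Du). Qed.

(** A quadratic form with real values comes from a symmetric operator. *)
Lemma A_symmetric c d : D c -> D d -> inner (A c) d = inner c (A d).
Proof.
move=> Dc Dd; have [l2c l2d] := (D_l2 Dc, D_l2 Dd); have [l2Ac l2Ad] := (A_l2 Dc, A_l2 Dd).
have cross alpha : Im (alpha * inner (A d) c + Num.conj alpha * inner (A c) d) = 0.
  have := inner_A_real (D_lin alpha Dd Dc).
  rewrite A_lin inner_linl ?inner_linr //; last exact: l2_lin.
  rewrite mulrDr mulrA mul_conj_norm !ImD (ImM _ (inner (A d) d)) /=.
  by rewrite (inner_A_real Dc) (inner_A_real Dd); lra.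
have h1 := cross 1; have hi := cross (0 +i* 1).
move: h1 hi; rewrite (inner_conj l2Ad l2c) rmorph1 !mul1r !conjE.
case: (inner (A d) c) (inner (A c) d) => [x y] [x' y'] /= h1 hi.
by apply: complex_eqP => /=; lra.
Qed.

(** [A] preserves the ranges of [E B] and of its complement, so the eigenvalue
    equation can be projected. *)
Lemma eigenvector_E B (x : R) c : measurable B -> D c ->
  A c = (fun n => x%:C * c n) -> A (E B c) = fun n => x%:C * E B c n.
Proof.
move=> mB Dc Ac; have l2c := D_l2 Dc; have mBc := measurableC mB.
have uB := in_rangeE mB l2c; have vB := in_range_resid mB l2c.
have Du := in_range_E_dom mB Dc; have Dv := D_resid mB Dc.
have AuB := A_in_range mB uB Du.
have AvB := A_in_range mBc vB Dv.
have Av0 : E B (A (fun n => c n - E B c n)) = fun=> 0.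
  by rewrite -[B in E B _]setCK; exact: in_range_compl0.
have : A c = fun n => 1 * A (E B c) n + A (fun n => c n - E B c n) n.
  by rewrite -A_lin; congr A; apply/funext => n; ring.
rewrite Ac => /(congr1 (E B)); rewrite E_lin // ?AuB.2 ?Av0; last 2 first.
- exact: AuB.1.
- exact: AvB.1.
move=> H; rewrite -[LHS]AuB.2.
transitivity (E B (fun n => x%:C * c n)).
  by rewrite H AuB.2; apply/funext => n; rewrite mul1r addr0.
transitivity (E B (fun n => x%:C * c n + 0)).
  by congr (E B _); apply/funext => n; rewrite addr0.
rewrite E_lin //; last exact: l2_0.
by apply/funext => n; rewrite (E_zero mB) addr0.
Qed.

(** On this range the quadratic form is at least [(x + eps) |u|^2], whereas the
    projected eigenvector gives [x |u|^2]. *)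
Lemma eigenvector_E_far_right (x eps : R) c : 0 < eps -> D c ->
  A c = (fun n => x%:C * c n) -> E `[x + eps, +oo[ c = fun=> 0.
Proof.
move=> eps0 Dc Ac; set B := [set` _].
have mB : measurable (B : set (measurableTypeR R)) by exact: measurable_itv.
have l2c := D_l2 Dc; have uB := in_rangeE mB l2c.
have := inner_A_ge (M := x + eps) mB uB (in_range_E_dom mB Dc).
rewrite (eigenvector_E mB Dc Ac) innerZl ?inner_norm ?uB.1 //; try exact: E_l2.
rewrite -rmorphM /= => H.
have {}H : (x + eps) * l2norm (E B c) ^+ 2 <= x * l2norm (E B c) ^+ 2.
  by apply: H => y; rewrite /B /= in_itv /= andbT.
apply: l2norm0_eq0; first exact: E_l2.
apply/eqP; rewrite -sqrf_eq0 eq_le sqr_ge0 andbT -(pmulr_rle0 _ eps0).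
by lra.
Qed.

Lemma eigenvector_E_far_left (x eps : R) c : 0 < eps -> D c ->
  A c = (fun n => x%:C * c n) -> E `]-oo, x - eps] c = fun=> 0.
Proof.
move=> eps0 Dc Ac; set B := [set` _].
have mB : measurable (B : set (measurableTypeR R)) by exact: measurable_itv.
have l2c := D_l2 Dc; have uB := in_rangeE mB l2c.
have := inner_A_le (M := x - eps) mB uB (in_range_E_dom mB Dc).
rewrite (eigenvector_E mB Dc Ac) innerZl ?inner_norm ?uB.1 //; try exact: E_l2.
rewrite -rmorphM /= => H.
have {}H : x * l2norm (E B c) ^+ 2 <= (x - eps) * l2norm (E B c) ^+ 2.
  by apply: H => y; rewrite /B /= in_itv /=.
apply: l2norm0_eq0; first exact: E_l2.
apply/eqP; rewrite -sqrf_eq0 eq_le sqr_ge0 andbT -(pmulr_rle0 _ eps0).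
by lra.
Qed.

(** The eigenvector lies in the range of [E U] for each neighbourhood [U] of [x],
    and [c k = <c, E U e_k>] would vanish with [E U e_k]. *)
Lemma eigenvalue_supp (x : R) c k : D c -> A c = (fun n => x%:C * c n) ->
  c k != 0 ->
  supp (fun B => (Re (inner (E B (unit_seq R k)) (unit_seq R k)))%:E) x.
Proof.
move=> Dc Ac ck U oU Ux.
have l2c := D_l2 Dc; have l2e := D_l2 (D_unit k).
have mU : measurable (U : set (measurableTypeR R)) by exact: open_measurable.
have mUc := measurableC mU.
have /nbhs_ballP[eps /= eps0 epsU] := open_nbhs_nbhs (conj oU Ux).
pose Br := `[x + eps, +oo[%classic : set (measurableTypeR R).
pose Bl := `]-oo, x - eps]%classic : set (measurableTypeR R).
have mBr : measurable Br by exact: measurable_itv.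
have mBl : measurable Bl by exact: measurable_itv.
have Er : E Br c = fun=> 0 := eigenvector_E_far_right eps0 Dc Ac.
have El : E Bl c = fun=> 0 := eigenvector_E_far_left eps0 Dc Ac.
have EUc : E (~` U) c = fun=> 0.
  apply: l2norm0_eq0; first exact: E_l2.
  have E1 : E (~` U `&` Br) c = fun=> 0.
    apply: (weight0_subset _ mBr l2c (@subIsetr _ _ _) Er); exact: measurableI.
  have E2 : E (~` U `&` ~` Br) c = fun=> 0.
    apply: (weight0_subset _ mBl l2c _ El).
      by apply: measurableI => //; exact: measurableC.
    move=> y [Uy]; rewrite /Br /Bl /= !in_itv /= andbT => /negP; rewrite -ltNge => yr.
    rewrite leNgt; apply/negP => yl; apply: Uy; apply: epsU.
    by rewrite /ball /= ltr_norml; lra.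
  have := weight_split mUc mBr l2c.
  by rewrite E1 E2 !l2norm_0 expr0n /= addr0 => /eqP; rewrite sqrf_eq0 => /eqP.
have [_ EU] : in_range U c by exact: compl0_in_range.
rewrite inner_E //= lte_fin lt_def sqr_ge0 andbT.
apply: contraNneq ck => /eqP; rewrite sqrf_eq0 => /eqP/(l2norm0_eq0 (E_l2 mU l2e)) h.
by apply/eqP; rewrite -(inner_unitr k l2c) -EU E_sym // h inner_conj ?inner0l ?rmorph0 //; exact: l2_0.
Qed.

(** A symmetric form bounded by [eps |w|^2] is bounded by [eps] as an operator:
    polarize between [u] and [g / eps] with [g = (A - x) u]. *)
Lemma approximate_eigenvector (x eps : R) u :
  0 < eps -> in_range (`]x - eps, x + eps[%classic : set (measurableTypeR R)) u ->
  D u /\ l2norm (fun n => A u n - x%:C * u n) <= eps * l2norm u.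
Proof.
move=> eps0; set B := [set` _] => uB.
have mB : measurable (B : set (measurableTypeR R)) by exact: measurable_itv.
have inD w : in_range B w -> D w.
  apply: (in_range_dom (M := (`|x| + eps) ^+ 2) mB) => y; rewrite /B /= in_itv /= => /andP[y1 y2].
  have hy : `|y| <= `|x| + eps.
    by rewrite ler_norml; have := ler_norm x; have := ler_norm (- x); rewrite normrN; lra.
  by rewrite -[leLHS]real_normK ?num_real // lerXn2r ?nnegrE // (le_trans _ hy).
have Du := inD u uB; split=> //; have l2u := uB.1; have AuB := A_in_range mB uB Du.
pose g n := A u n - x%:C * u n.
have gB : in_range B g.
  rewrite (_ : g = fun n => - x%:C * u n + A u n); first exact: in_range_lin.
  by apply/funext => n; rewrite /g addrC mulNr.
have Dg := inD g gB; have l2g := gB.1.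
pose q w := Re (inner (A w) w) - x * l2norm w ^+ 2.
have q_le w : in_range B w -> q w <= eps * l2norm w ^+ 2.
  move=> wB; have := inner_A_le (M := x + eps) mB wB (inD w wB).
  rewrite /q => h; suff : Re (inner (A w) w) <= (x + eps) * l2norm w ^+ 2 by lra.
  by apply: h => y; rewrite /B /= in_itv /= => /andP[_ /ltW].
have q_ge w : in_range B w -> - (eps * l2norm w ^+ 2) <= q w.
  move=> wB; have := inner_A_ge (M := x - eps) mB wB (inD w wB).
  rewrite /q => h; suff : (x - eps) * l2norm w ^+ 2 <= Re (inner (A w) w) by lra.
  by apply: h => y; rewrite /B /= in_itv /= => /andP[/ltW].
have l2Au := A_l2 Du; have l2Ag := A_l2 Dg.
have gg : inner (A g) u - x%:C * inner g u = (l2norm g ^+ 2)%:C.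
  rewrite -inner_norm // {3}/g innerBr ?innerZr //; last exact: l2Z.
  by rewrite A_symmetric // conjE conjc_real.
have polar (t : R) : q (fun n => t%:C * g n + u n) - q (fun n => (- t)%:C * g n + u n) =
    4 * t * l2norm g ^+ 2.
  have expand (r : R) : q (fun n => r%:C * g n + u n) =
      r ^+ 2 * q g + q u + 2 * r * l2norm g ^+ 2.
    rewrite /q; set w := fun n => _.
    have l2w : l2 w by exact: l2_lin.
    have Ew : (l2norm w ^+ 2)%:C = r%:C * (r%:C * inner g g + inner g u) +
        (r%:C * Num.conj (inner g u) + inner u u).
      rewrite -inner_norm // /w inner_linl ?inner_linr // ?(inner_conj l2g l2u) //.
      by rewrite conjE conjc_real.
    have EA : inner (A w) w = r%:C * (r%:C * inner (A g) g + inner (A g) u) +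
        (r%:C * Num.conj (inner (A g) u) + inner (A u) u).
      rewrite /w A_lin inner_linl ?inner_linr // conjE conjc_real.
      by rewrite (A_symmetric Du Dg) (inner_conj l2Ag l2u).
    move/(congr1 (@complex.Re R)) : Ew => /= ->; rewrite EA.
    have /= gg' := congr1 (@complex.Re R) gg.
    by rewrite !inner_norm //; exact: shifted_form_expansion.
  by rewrite (expand t) (expand (- t)); ring.
have parallelogram (t : R) : l2norm (fun n => t%:C * g n + u n) ^+ 2 +
    l2norm (fun n => (- t)%:C * g n + u n) ^+ 2 = 2 * t ^+ 2 * l2norm g ^+ 2 + 2 * l2norm u ^+ 2.
  have expand (r : R) : l2norm (fun n => r%:C * g n + u n) ^+ 2 =
      r ^+ 2 * l2norm g ^+ 2 + l2norm u ^+ 2 + 2 * r * Re (inner g u).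
    set w := fun n => _; have l2w : l2 w by exact: l2_lin.
    have Ew : (l2norm w ^+ 2)%:C = r%:C * (r%:C * inner g g + inner g u) +
        (r%:C * Num.conj (inner g u) + inner u u).
      rewrite -inner_norm // /w inner_linl ?inner_linr // ?(inner_conj l2g l2u) //.
      by rewrite conjE conjc_real.
    move/(congr1 (@complex.Re R)) : Ew => /= ->; rewrite !inner_norm //.
    by case: (inner g u) => [? ?] /=; ring.
  by rewrite (expand t) (expand (- t)); ring.
have wB (r : R) : in_range B (fun n => r%:C * g n + u n) by exact: in_range_lin.
have h1 := q_le _ (wB eps^-1); have h2 := q_ge _ (wB (- eps^-1)).
have hp := polar eps^-1; have hl := parallelogram eps^-1.
have {h1 h2 hp hl} key : 4 * eps^-1 * l2norm g ^+ 2 <=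
    eps * (2 * eps^-1 ^+ 2 * l2norm g ^+ 2 + 2 * l2norm u ^+ 2).
  by rewrite -hp -hl; lra.
have eps_neq0 : eps != 0 by rewrite gt_eqF.
have {}key : l2norm g ^+ 2 <= (eps * l2norm u) ^+ 2.
  have := ler_wpM2l (ltW eps0) key.
  rewrite (_ : eps * (4 * eps^-1 * l2norm g ^+ 2) = 4 * l2norm g ^+ 2); last by field.
  rewrite (_ : eps * (eps * _) = 2 * l2norm g ^+ 2 + 2 * (eps * l2norm u) ^+ 2); last by field.
  by lra.
by rewrite -(@ler_pXn2r _ 2) ?nnegrE ?mulr_ge0 ?l2norm_ge0 // ltW.
Qed.

End SpectralMeasure.

(** * Complex integrals and Cauchy kernels *)

Section ComplexIntegral.
Variables (R : realType) (nu : probability (measurableTypeR R) R).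
Implicit Types (f g : R -> R) (F G : R -> R[i]) (alpha : R[i]).

Definition rintegrable f : Prop := nu.-integrable setT (EFin \o f).

Lemma rintegrableD f g : rintegrable f -> rintegrable g ->
  rintegrable (fun x => f x + g x).
Proof. exact: integrableD. Qed.

Lemma rintegrableZ (k : R) f : rintegrable f -> rintegrable (fun x => k * f x).
Proof. exact: integrableZl. Qed.

Lemma rintegrable_measurable f : rintegrable f -> measurable_fun [set: R] f.
Proof. by move=> /measurable_int /measurable_EFinP. Qed.

Lemma rintegrable_bounded f (M : R) : measurable_fun [set: R] f ->
  (forall x, `|f x| <= M) -> rintegrable f.
Proof.
move=> mf fM; apply: measurable_bounded_integrable => //.
  by rewrite [X in (X < _)%E](probability_setT nu) ltry.
by exists M; split; [exact: num_real|move=> r /ltW Mr x _ /=; exact: le_trans (fM x) Mr].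
Qed.

Lemma rintegrableM f g (M : R) : measurable_fun [set: R] f ->
  (forall x, `|f x| <= M) -> rintegrable g -> rintegrable (fun x => f x * g x).
Proof.
move=> mf fM ig.
have bf : [bounded f x | x in (setT : set (measurableTypeR R))].
  by exists M; split; [exact: num_real|move=> r /ltW Mr x _ /=; exact: le_trans (fM x) Mr].
have mf' : measurable_fun (setT : set (measurableTypeR R)) (f : measurableTypeR R -> R) := mf.
exact: (integrableMr measurableT mf' bf ig).
Qed.

Lemma RintD f g : rintegrable f -> rintegrable g ->
  (\int[nu]_x (f x + g x) = \int[nu]_x f x + \int[nu]_x g x)%R.
Proof. by move=> fi gi; rewrite RintegralD. Qed.

Lemma RintZ (k : R) f : rintegrable f -> (\int[nu]_x (k * f x) = k * \int[nu]_x f x)%R.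
Proof. by move=> fi; rewrite RintegralZl. Qed.

Definition cintegrable F : Prop :=
  rintegrable (fun x => Re (F x)) /\ rintegrable (fun x => Im (F x)).

Lemma cintegrableD F G : cintegrable F -> cintegrable G ->
  cintegrable (fun x => F x + G x).
Proof.
move=> [f1 f2] [g1 g2]; split.
  by rewrite (_ : (fun x => _) = fun x => Re (F x) + Re (G x));
    [exact: rintegrableD|apply/funext => x; exact: ReD].
by rewrite (_ : (fun x => _) = fun x => Im (F x) + Im (G x));
  [exact: rintegrableD|apply/funext => x; exact: ImD].
Qed.

Lemma CintegralD F G : cintegrable F -> cintegrable G ->
  Cintegral nu (fun x => F x + G x) = Cintegral nu F + Cintegral nu G.
Proof.
move=> [f1 f2] [g1 g2]; apply: complex_eqP; rewrite /Cintegral /= -RintD //.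
  by congr Rintegral; apply/funext => x; exact: ReD.
by congr Rintegral; apply/funext => x; exact: ImD.
Qed.

Lemma cintegrableZ alpha F : cintegrable F -> cintegrable (fun x => alpha * F x).
Proof.
move=> [f1 f2]; split.
  rewrite (_ : (fun x => _) = fun x => Re alpha * Re (F x) + (- Im alpha) * Im (F x)).
    by apply: rintegrableD; exact: rintegrableZ.
  by apply/funext => x; rewrite ReM mulNr.
rewrite (_ : (fun x => _) = fun x => Re alpha * Im (F x) + Im alpha * Re (F x)).
  by apply: rintegrableD; exact: rintegrableZ.
by apply/funext => x; rewrite ImM.
Qed.

Lemma CintegralZ alpha F : cintegrable F ->
  Cintegral nu (fun x => alpha * F x) = alpha * Cintegral nu F.
Proof.
move=> [f1 f2]; apply: complex_eqP; rewrite ?ReM ?ImM /Cintegral /=.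
  rewrite -mulNr -!RintZ // -RintD; try exact: rintegrableZ.
  by congr Rintegral; apply/funext => x; rewrite ReM mulNr.
rewrite -!RintZ // -RintD; try exact: rintegrableZ.
by congr Rintegral; apply/funext => x; rewrite ImM.
Qed.

Lemma cintegrable_real f : rintegrable f -> cintegrable (fun x => (f x)%:C).
Proof.
move=> fi; split=> //=; apply: (@rintegrable_bounded _ 0); first exact: measurable_cst.
by move=> x; rewrite normr0.
Qed.

Lemma Cintegral_real f : Cintegral nu (fun x => (f x)%:C) = ((\int[nu]_x f x)%R)%:C.
Proof. by apply: complex_eqP => //=; rewrite Rintegral_cst // mul0r. Qed.

Lemma jacobi_Cintegral (a b : nat -> R) (H : nat -> R -> R[i]) n :
  (forall k, cintegrable (H k)) ->
  jacobi a b (fun k => Cintegral nu (H k)) n =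
  Cintegral nu (fun x => jacobi a b (H^~ x) n).
Proof.
move=> iH; rewrite /jacobi; case: n => [|n].
  under [in RHS]eq_fun do rewrite add0r.
  by rewrite add0r CintegralD ?CintegralZ //; exact: cintegrableZ.
rewrite CintegralD ?CintegralD ?CintegralZ //; try exact: cintegrableZ.
by apply: cintegrableD; exact: cintegrableZ.
Qed.

End ComplexIntegral.

Section CauchyKernel.
Variable R : realType.

Definition cauchy_kernel (z : R[i]) (x : R) : R[i] := (x%:C - z)^-1.

Variable z : R[i].
Hypothesis z_nonreal : Im z != 0.

Lemma sub_nonreal_neq0 x : x%:C - z != 0.
Proof.
apply: contraNneq z_nonreal => /(congr1 (@complex.Im R)).
by case: z => z1 z2 /=; rewrite sub0r => /eqP; rewrite oppr_eq0.
Qed.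

Lemma cauchy_kernelE x : (x%:C - z) * cauchy_kernel z x = 1.
Proof. by rewrite mulfV ?sub_nonreal_neq0. Qed.

Lemma cauchy_kernel_bounded x : Normc.normc (cauchy_kernel z x) <= `|Im z|^-1.
Proof.
rewrite Normc.normcV lef_pV2 ?posrE ?normr_gt0 //.
  by apply: le_trans (abs_Im_le _); case: z => z1 z2 /=; rewrite sub0r normrN.
by apply: lt_le_trans (abs_Im_le _); case: z z_nonreal => z1 z2 /= h; rewrite sub0r normrN normr_gt0.
Qed.

Lemma cauchy_kernel_measurable :
  measurable_fun [set: R] (fun x => Re (cauchy_kernel z x)) /\
  measurable_fun [set: R] (fun x => Im (cauchy_kernel z x)).
Proof.
case: z z_nonreal => z1 z2 /= z20.
have den_cont : continuous (fun x : R => ((x - z1) ^+ 2 + z2 ^+ 2)^-1).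
  move=> x; apply: cvgV.
    by rewrite gt_eqF // ltr_wpDl ?sqr_ge0 // lt_def sqr_ge0 sqrf_eq0 z20.
  apply: cvgD; last exact: cvg_cst.
  by apply: cvgM; apply: cvgB; [exact: cvg_id|exact: cvg_cst|exact: cvg_id|exact: cvg_cst].
have mden := continuous_measurable_fun den_cont.
rewrite /cauchy_kernel; split.
  rewrite (_ : (fun x => _) = (fun x => (x - z1) * ((x - z1) ^+ 2 + z2 ^+ 2)^-1)).
    by apply: measurable_funM => //; apply: measurable_funB => //; exact: measurable_cst.
  by apply/funext => x /=; rewrite sub0r sqrrN.
rewrite (_ : (fun x => _) = (fun x => z2 * ((x - z1) ^+ 2 + z2 ^+ 2)^-1)).
  by apply: measurable_funM => //; exact: measurable_cst.
by apply/funext => x /=; rewrite sub0r sqrrN mulNr opprK.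
Qed.

Lemma cauchy_kernel_integrable (nu : probability (measurableTypeR R) R) :
  cintegrable nu (cauchy_kernel z).
Proof.
have [mR mI] := cauchy_kernel_measurable.
split; apply: (@rintegrable_bounded _ nu _ (`|Im z|^-1)) => // x;
  apply: le_trans (cauchy_kernel_bounded x).
  exact: abs_Re_le.
exact: abs_Im_le.
Qed.

Lemma cauchy_kernelM_integrable (nu : probability (measurableTypeR R) R) (f : R -> R) :
  rintegrable nu f -> cintegrable nu (fun x => (f x)%:C * cauchy_kernel z x).
Proof.
move=> fi; have [mR mI] := cauchy_kernel_measurable; split.
  rewrite (_ : (fun x => _) = fun x => Re (cauchy_kernel z x) * f x).
    apply: (rintegrableM mR _ fi) => x.
    exact: le_trans (abs_Re_le _) (cauchy_kernel_bounded x).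
  by apply/funext => x; rewrite ReM /= mul0r subr0 mulrC.
rewrite (_ : (fun x => _) = fun x => Im (cauchy_kernel z x) * f x).
  apply: (rintegrableM mI _ fi) => x.
  exact: le_trans (abs_Im_le _) (cauchy_kernel_bounded x).
by apply/funext => x; rewrite ImM /= mul0r addr0 mulrC.
Qed.

End CauchyKernel.

(** * Orthonormal polynomials and the Cauchy kernel *)

Section Moments.
Variables (R : realType) (nu : probability (measurableTypeR R) R).
Hypothesis nu_moments : forall n, nu.-integrable setT (fun x => (x ^+ n)%:E).
Implicit Types (P Q : {poly R}) (g : R -> R).

Lemma poly_integrable P : rintegrable nu (fun x => P.[x]).
Proof.
suff H k : rintegrable nu (fun x => P.[x] * x ^+ k).
  by have := H 0%N; congr rintegrable; apply/funext => x; rewrite mulr1.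
elim/poly_ind: P k => [|P c IH] k.
  rewrite (_ : (fun x => _) = fun x => 0 * x ^+ k).
    by apply: rintegrableZ; exact: nu_moments.
  by apply/funext => x; rewrite horner0.
rewrite (_ : (fun x => _) = fun x => P.[x] * x ^+ k.+1 + c * x ^+ k).
  by apply: rintegrableD; [exact: IH|apply: rintegrableZ; exact: nu_moments].
by apply/funext => x; rewrite !hornerE exprS; ring.
Qed.

Definition weighted g P : R := (\int[nu]_x (g x * P.[x]))%R.

Section Weighted.
Variables (g : R -> R) (M : R).
Hypothesis mg : measurable_fun [set: R] g.
Hypothesis g_le : forall x, `|g x| <= M.

Lemma weighted_integrable P : rintegrable nu (fun x => g x * P.[x]).
Proof. exact: rintegrableM mg g_le (poly_integrable P). Qed.

Lemma weightedD P Q : weighted g (P + Q) = weighted g P + weighted g Q.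
Proof.
rewrite /weighted -RintD; try exact: weighted_integrable.
by congr Rintegral; apply/funext => x; rewrite hornerD mulrDr.
Qed.

Lemma weightedZ (k : R) P : weighted g (k *: P) = k * weighted g P.
Proof.
rewrite /weighted -RintZ; last exact: weighted_integrable.
by congr Rintegral; apply/funext => x; rewrite hornerZ; ring.
Qed.

Lemma weighted_sum (c : nat -> R) (F : nat -> {poly R}) N :
  weighted g (\sum_(n < N) c n *: F n) = \sum_(n < N) c n * weighted g (F n).
Proof.
elim: N => [|N IH]; last by rewrite !big_ord_recr /= weightedD weightedZ IH.
by rewrite !big_ord0 -(scale0r 0) weightedZ mul0r.
Qed.

End Weighted.

Let one_le (x : R) : `|(fun=> 1 : R) x| <= 1. Proof. by rewrite normr1. Qed.
Let m1 : measurable_fun [set: R] (fun=> 1 : R). Proof. exact: measurable_cst. Qed.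

Variable p : nat -> {poly R}.
Hypothesis p_on : forall n m, (\int[nu]_x ((p n).[x] * (p m).[x]))%R = (n == m)%:R.

Lemma weighted1_on n m : weighted (fun=> 1) (p n * p m) = (n == m)%:R.
Proof.
rewrite -p_on /weighted; congr Rintegral; apply/funext => x.
by rewrite mul1r hornerM.
Qed.

(** The square of the distance from [g] to the span of the first polynomials is
    nonnegative. *)
Lemma bessel_inequality g (M : R) : measurable_fun [set: R] g -> (forall x, `|g x| <= M) ->
  forall N, \sum_(n < N) weighted g (p n) ^+ 2 <= M ^+ 2.
Proof.
move=> mg gM N; have M0 : 0 <= M by exact: le_trans (gM 0).
pose c n := weighted g (p n); pose P := \sum_(n < N) c n *: p n.
have gP : weighted g P = \sum_(n < N) c n ^+ 2.
  by rewrite (weighted_sum mg gM c p N).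
have Pp m : (m < N)%N -> weighted (fun=> 1) (P * p m) = c m.
  move=> mN; rewrite mulr_suml.
  under eq_bigr do rewrite -scalerAl.
  rewrite (weighted_sum m1 one_le c (fun n => p n * p m) N).
  rewrite (bigD1 (Ordinal mN)) //= weighted1_on eqxx mulr1 big1 ?addr0 // => n nm.
  rewrite weighted1_on; case: eqP => [e|]; last by rewrite mulr0.
  by case/eqP: nm; apply: val_inj.
have PP : weighted (fun=> 1) (P * P) = \sum_(n < N) c n ^+ 2.
  rewrite {2}/P mulr_sumr.
  under eq_bigr do rewrite -scalerAr.
  rewrite (weighted_sum m1 one_le c (fun n => P * p n) N).
  by apply: eq_bigr => n _; rewrite Pp.
have ig2 : rintegrable nu (fun x => g x ^+ 2).
  apply: (@rintegrable_bounded _ nu _ (M ^+ 2)); first exact: measurable_funX.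
  by move=> x; rewrite normrX lerXn2r ?nnegrE.
have igP := weighted_integrable mg gM P.
have iPP := weighted_integrable m1 one_le (P * P).
have : 0 <= (\int[nu]_x (g x ^+ 2 + ((-2) * (g x * P.[x]) + 1 * (P * P).[x])))%R.
  apply: Rintegral_ge0 => x _; rewrite hornerM mul1r.
  by rewrite (_ : _ + _ = (g x - P.[x]) ^+ 2) ?sqr_ge0 //; ring.
rewrite RintD //; last by apply: rintegrableD => //; exact: rintegrableZ.
rewrite RintD //; last exact: rintegrableZ.
rewrite RintZ // -/(weighted g P) -/(weighted (fun=> 1) (P * P)) gP PP.
have : (\int[nu]_x g x ^+ 2)%R <= M ^+ 2.
  apply: (@le_trans _ _ (\int[nu]_x M ^+ 2)%R).
    apply: le_Rintegral => //.
      by apply: (@rintegrable_bounded _ nu _ (M ^+ 2)) => // x; rewrite ger0_norm ?sqr_ge0.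
    by move=> x _; rewrite -[leLHS]real_normK ?num_real // lerXn2r ?nnegrE.
  by rewrite Rintegral_cst // [X in _ * fine X](probability_setT nu) mulr1.
by rewrite -/c => h1 h2; lra.
Qed.

Variables a b : nat -> R.
Hypothesis p0 : p 0%N = 1.
Hypothesis rec : forall n, 'X * p n = a n *: p n.+1 + b n *: p n
                       + (if n is m.+1 then a m *: p m else 0).
Variable z : R[i].
Hypothesis z_nonreal : Im z != 0.

(** Fourier coefficients of the Cauchy kernel in the orthonormal polynomials. *)
Definition cauchy_coef (n : nat) : R[i] :=
  Cintegral nu (fun x => ((p n).[x])%:C * cauchy_kernel z x).

Lemma cauchy_coef0 : cauchy_coef 0 = Cintegral nu (cauchy_kernel z).
Proof. by congr Cintegral; apply/funext => x; rewrite p0 hornerC mul1r. Qed.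

Lemma cauchy_coef_l2 : l2 cauchy_coef.
Proof.
have [mR mI] := cauchy_kernel_measurable z_nonreal.
have leR x : `|Re (cauchy_kernel z x)| <= `|Im z|^-1.
  exact: le_trans (abs_Re_le _) (cauchy_kernel_bounded z_nonreal x).
have leI x : `|Im (cauchy_kernel z x)| <= `|Im z|^-1.
  exact: le_trans (abs_Im_le _) (cauchy_kernel_bounded z_nonreal x).
apply: (@l2_bounded _ _ (`|Im z|^-1 ^+ 2 + `|Im z|^-1 ^+ 2)) => N.
apply: le_trans (lerD (bessel_inequality mR leR N) (bessel_inequality mI leI N)).
rewrite -big_split; apply: ler_sum => n _; rewrite normc_sq.
rewrite /cauchy_coef /Cintegral /weighted /=.
rewrite le_eqVlt; apply/orP; left; apply/eqP; congr (_ ^+ 2 + _ ^+ 2).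
  by congr Rintegral; apply/funext => x; rewrite ReM /= mul0r subr0 mulrC.
by congr Rintegral; apply/funext => x; rewrite ImM /= mul0r addr0 mulrC.
Qed.

(** Multiplying the kernel by [x] gives [z] times the kernel plus 1, and the
    integral of [p n] is the unit sequence. *)
Lemma jacobi_cauchy_coef n :
  jacobi a b cauchy_coef n = z * cauchy_coef n + unit_seq R 0 n.
Proof.
pose F m x := ((p m).[x])%:C * cauchy_kernel z x.
have iF m : cintegrable nu (F m).
  by apply: cauchy_kernelM_integrable => //; exact: poly_integrable.
have ip := cintegrable_real (poly_integrable (p n)).
have -> : unit_seq R 0 n = Cintegral nu (fun x => ((p n).[x])%:C).
  rewrite Cintegral_real /unit_seq; apply: complex_eqP; rewrite /= -?p_on.
    rewrite -(rmorph_nat (real_complex R)) /= -p_on; congr Rintegral.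
    by apply/funext => x; rewrite p0 hornerC mulr1.
  by rewrite -(rmorph_nat (real_complex R)).
have pointwise x : jacobi a b (F^~ x) n = z * F n x + ((p n).[x])%:C.
  have := congr1 (fun P => (P.[x])%:C * cauchy_kernel z x) (rec n).
  have xk : x%:C * cauchy_kernel z x = z * cauchy_kernel z x + 1.
    by rewrite -(cauchy_kernelE z_nonreal x); ring.
  rewrite hornerM hornerX rmorphM mulrAC xk /F => H.
  transitivity ((z * cauchy_kernel z x + 1) * ((p n).[x])%:C); last by ring.
  rewrite H /jacobi; case: n {ip H} => [|m].
    by rewrite !hornerE !rmorphD !rmorphM /=; ring.
  by rewrite !hornerE !rmorphD !rmorphM /=; ring.
change (jacobi a b (fun k => Cintegral nu (F k)) n =
  z * Cintegral nu (F n) + Cintegral nu (fun x => ((p n).[x])%:C)).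
rewrite -(CintegralZ z (iF n)) -(CintegralD (cintegrableZ z (iF n)) ip) jacobi_Cintegral //.
by congr Cintegral; apply/funext.
Qed.

End Moments.

(** * Uniqueness of the Cauchy transform *)

Section StieltjesUniqueness.
Variables (R : realType) (m1 m2 : probability (measurableTypeR R) R).
Implicit Types (F G : R -> R[i]) (f : R -> R).

Definition agree F :=
  [/\ cintegrable m1 F, cintegrable m2 F & Cintegral m1 F = Cintegral m2 F].

Lemma agreeD F G : agree F -> agree G -> agree (fun x => F x + G x).
Proof.
move=> [F1 F2 eF] [G1 G2 eG]; split; try exact: cintegrableD.
by rewrite !CintegralD // eF eG.
Qed.

Lemma agreeZ alpha F : agree F -> agree (fun x => alpha * F x).
Proof.
move=> [F1 F2 eF]; split; try exact: cintegrableZ.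
by rewrite !CintegralZ // eF.
Qed.

Hypothesis m12 : forall z : R[i], Im z != 0 ->
  Cintegral m1 (cauchy_kernel z) = Cintegral m2 (cauchy_kernel z).

Lemma agree_kernel (z : R[i]) : Im z != 0 -> agree (cauchy_kernel z).
Proof. by move=> z0; split; [exact: cauchy_kernel_integrable..|exact: m12]. Qed.

Lemma one_sub_nonreal_neq0 (c : R[i]) (v : R) : Im c != 0 -> 1 - c * v%:C != 0.
Proof.
move=> c0; apply/eqP => h.
have := congr1 (@complex.Im R) h; have := congr1 (@complex.Re R) h.
case: c c0 {h} => c1 c2 /= c20; rewrite !mulr0 subr0 !add0r.
move=> hre /eqP; rewrite oppr_eq0 mulf_eq0 (negbTE c20) /= => /eqP v0.
by move: hre; rewrite v0 mulr0 subr0 => /eqP; rewrite oner_eq0.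
Qed.

Section Bump.
Variables y rho : R.
Hypothesis rho0 : 0 < rho.

Definition scaled (x : R) : R := (x - y) / rho.

Definition resolvent_power (j : nat) (c : R[i]) (x : R) : R[i] :=
  (1 - c * (scaled x ^+ (2 ^ j))%:C)^-1.

Let rhoC : rho%:C != 0.
Proof. by rewrite -(rmorph0 (real_complex R)) (inj_eq (@complexI R)) gt_eqF. Qed.

(** [1 / (1 - c^2 v^2) = (1 / (1 - c v) + 1 / (1 + c v)) / 2]; square roots of
    a nonreal number are nonreal, so the identity can be iterated. *)
Lemma agree_resolvent_power j (c : R[i]) : Im c != 0 -> agree (resolvent_power j c).
Proof.
elim: j c => [|j IH] c c0.
  have cn0 : c != 0 by apply: contraNneq c0 => ->.
  pose z := y%:C + rho%:C / c.
  have z0 : Im z != 0.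
    rewrite /z ImD /= add0r.
    apply: contraNneq c0 => h0.
    have : c = rho%:C / (rho%:C / c) by field; rewrite rhoC cn0.
    case: (rho%:C / c) h0 => w1 w2 /= -> ->.
    by rewrite ImM /= mul0r oppr0 mul0r mulr0 addr0.
  have := agreeZ (- (rho%:C / c)) (agree_kernel z0); congr agree; apply/funext => x.
  rewrite /resolvent_power /cauchy_kernel /scaled expn0 expr1.
  have -> : x%:C - z = - (rho%:C / c) * (1 - c * ((x - y) / rho)%:C).
    rewrite /z rmorphM rmorphB /= fmorphV; field.
    by rewrite rhoC cn0.
  rewrite invfM mulrA mulfV ?mul1r // oppr_eq0 mulf_neq0 // invr_eq0 //.
pose s := sqrtc c.
have s2 : s ^+ 2 = c by exact: sqr_sqrtc.
have s0 : Im s != 0.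
  apply: contraNneq c0 => h; rewrite -s2 expr2 ImM h.
  by rewrite mulr0 mul0r addr0.
have s0' : Im (- s) != 0 by case: s s0 {s2} => ? ? /=; rewrite oppr_eq0.
have := agreeZ (2^-1) (agreeD (IH s s0) (IH (- s) s0')).
congr agree; apply/funext => x; rewrite /resolvent_power.
set v := scaled x ^+ (2 ^ j).
have -> : scaled x ^+ (2 ^ j.+1) = v ^+ 2 by rewrite /v -exprM expnSr.
have h1 := one_sub_nonreal_neq0 v s0; have h2 := one_sub_nonreal_neq0 v s0'.
have e : 1 - c * (v ^+ 2)%:C = (1 - s * v%:C) * (1 - - s * v%:C).
  by rewrite -s2 rmorphXn /=; ring.
rewrite e; field.
by apply/andP.
Qed.

Definition bump (j : nat) (x : R) : R := (1 + scaled x ^+ (2 ^ j.+1))^-1.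

(** The two factors of [1 + v^2] have nonreal coefficients [i] and [- i]. *)
Lemma agree_bump j : agree (fun x => (bump j x)%:C).
Proof.
have i0 : Im (0 +i* 1 : R[i]) != 0 by rewrite /= oner_eq0.
have i0' : Im (- (0 +i* 1) : R[i]) != 0 by rewrite /= oppr_eq0 oner_eq0.
have := agreeZ (2^-1) (agreeD (agree_resolvent_power j i0) (agree_resolvent_power j i0')).
congr agree; apply/funext => x; rewrite /resolvent_power /bump.
set v := scaled x ^+ (2 ^ j).
have -> : scaled x ^+ (2 ^ j.+1) = v ^+ 2 by rewrite /v -exprM expnSr.
have h1 := one_sub_nonreal_neq0 v i0; have h2 := one_sub_nonreal_neq0 v i0'.
rewrite fmorphV /= rmorphD rmorph1 /=.
have -> : 1 + (v ^+ 2)%:C = (1 - (0 +i* 1) * v%:C) * (1 - - (0 +i* 1) * v%:C).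
  by apply: complex_eqP => /=; ring.
move: h1 h2; set w := (0 +i* 1) => h1 h2; field.
by apply/andP.
Qed.

End Bump.

Definition unit_agree f :=
  [/\ measurable_fun [set: measurableTypeR R] (f : measurableTypeR R -> R),
      forall x, 0 <= f x <= 1
    & (\int[m1]_x (f x)%:E = \int[m2]_x (f x)%:E)%E].

(** Dominated convergence, with the constant 1 as the bound. *)
Lemma unit_agree_lim (f_ : nat -> R -> R) f : (forall j, unit_agree (f_ j)) ->
  (forall x, f_ ^~ x @ \oo --> f x) -> unit_agree f.
Proof.
move=> uf fl.
have mf : measurable_fun [set: measurableTypeR R] (f : measurableTypeR R -> R).
  apply: (measurable_fun_cvg (h := f_)) => [j|x _]; last exact: fl.
  by have [] := uf j.
have f01 x : 0 <= f x <= 1.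
  apply/andP; split.
    by apply: (cvgr_to_ge (fl x)); near=> j; have [_ /(_ x)/andP[]] := uf j.
  by apply: (cvgr_to_le (fl x)); near=> j; have [_ /(_ x)/andP[]] := uf j.
have lim_int (m : probability (measurableTypeR R) R) :
    (fun j => \int[m]_x (f_ j x)%:E)%E @ \oo --> (\int[m]_x (f x)%:E)%E.
  have [] // := @dominated_convergence _ (measurableTypeR R) R m setT measurableT
    (fun j x => (f_ j x)%:E) (fun x => (f x)%:E) (cst 1%E).
  - by move=> j; apply/measurable_EFinP; have [] := uf j.
  - exact/measurable_EFinP.
  - by apply: aeW => x _; apply/fine_cvgP; split; [near=> j|exact: fl].
  - by apply: (@rintegrable_bounded _ m (fun=> 1) 1) => [|x]; rewrite ?normr1 //; exact: measurable_cst.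
  - by apply: aeW => x j _; rewrite /= lee_fin ger0_norm; have [_ /(_ x)/andP[]] := uf j.
split=> //; have := lim_int m1.
rewrite (_ : (fun j => _) = (fun j => \int[m2]_x (f_ j x)%:E)%E); last first.
  by apply/funext => j; have [] := uf j.
by move=> h; apply: (cvg_unique _ h (lim_int m2)).
Unshelve. all: by end_near. Qed.

Lemma unit_agree_bump y rho j : 0 < rho -> unit_agree (bump y rho j).
Proof.
move=> rho0; have [i1 i2] := agree_bump y rho0 j; rewrite !Cintegral_real => -[e].
have i1' : rintegrable m1 (bump y rho j) := i1.1.
have i2' : rintegrable m2 (bump y rho j) := i2.1.
split; first exact: rintegrable_measurable i1'.
  move=> x; rewrite /bump.
  have h : 0 <= scaled y rho x ^+ (2 ^ j.+1) by rewrite expnS exprM exprn_ge0 // sqr_ge0.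
  by rewrite invr_ge0 addr_ge0 // invf_le1 ?lerDl // ltr_wpDr.
by rewrite -[LHS]fineK ?(integrable_fin_num measurableT i1') // -[RHS]fineK ?(integrable_fin_num measurableT i2') //; congr EFin.
Qed.

Definition unit_window (s : R) : R :=
  if `|s| < 1 then 1 else if `|s| == 1 then 2^-1 else 0.

Lemma bump_lim (s : R) : (fun j => (1 + s ^+ (2 ^ j.+1))^-1) @ \oo --> unit_window s.
Proof.
have even_pow j : s ^+ (2 ^ j.+1) = `|s| ^+ (2 ^ j.+1).
  by rewrite expnS !exprM real_normK ?num_real.
have le_pow j : (j <= 2 ^ j.+1)%N by apply: ltnW; apply: ltn_trans (ltn_expl j (ltnSn 1)) _; rewrite ltn_exp2l.
have pow_lim (r : R) : 0 <= r -> r < 1 -> (fun j => r ^+ (2 ^ j.+1)) @ \oo --> (0 : R).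
  move=> r0 r1; apply: (@squeeze_cvgr _ _ _ _ (fun=> 0) (fun j => r ^+ j)).
  - near=> j; rewrite exprn_ge0 //=; apply: ler_wiXn2l => //; exact: ltW.
  - exact: cvg_cst.
  - by apply: cvg_expr; rewrite ger0_norm.
under eq_fun do rewrite even_pow.
rewrite /unit_window; case: ltgtP => [s1|s1|->].
- have H : (fun j => 1 + `|s| ^+ (2 ^ j.+1)) @ \oo --> (1 + 0 : R).
    by apply: cvgD; [exact: cvg_cst|exact: pow_lim].
  by have := cvgV _ H; rewrite addr0 invr1; apply; exact: oner_neq0.
- apply: (@squeeze_cvgr _ _ _ _ (fun=> 0) (fun j => `|s|^-1 ^+ (2 ^ j.+1))).
  + have s0 : 0 < `|s| by exact: lt_trans s1.
    near=> j; have h : 0 < `|s| ^+ (2 ^ j.+1) by rewrite exprn_gt0.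
    apply/andP; split; first by rewrite invr_ge0 addr_ge0 // ltW.
    by rewrite exprVn lef_pV2 ?posrE ?addr_gt0 // lerDr.
  + exact: cvg_cst.
  + by apply: pow_lim; rewrite ?invr_ge0 // invf_lt1 // (lt_trans _ s1).
- under eq_fun do rewrite expr1n.
  exact: cvg_cst.
Unshelve. all: by end_near. Qed.

Lemma unit_agree_step y rho : 0 < rho ->
  unit_agree (fun x => unit_window (scaled y rho x)).
Proof.
move=> rho0; apply: (@unit_agree_lim (bump y rho)) => [j|x]; first exact: unit_agree_bump.
exact: bump_lim.
Qed.

(** Shifting the window with ends [u] and [v] to the right by a positive amount
    that tends to 0 excludes [u] and includes [v] in the limit. *)
Lemma unit_agree_itv (u v : R) : u < v -> unit_agree (\1_(`]u, v]%classic : set R)).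
Proof.
move=> uv; pose eps (i : nat) : R := i.+1%:R^-1.
have eps0 i : 0 < eps i by rewrite /eps invr_gt0 ltr0n.
have rho0 : 0 < (v - u) / 2 by rewrite divr_gt0 // subr_gt0.
apply: (@unit_agree_lim (fun i x => unit_window (scaled ((u + v) / 2 + eps i) ((v - u) / 2) x))).
  by move=> i; exact: unit_agree_step.
move=> x; rewrite indicE.
have lt1 i : u + eps i < x -> x < v + eps i -> `|scaled ((u + v) / 2 + eps i) ((v - u) / 2) x| < 1.
  move=> h1 h2; rewrite /scaled normrM [X in _ * X]gtr0_norm ?invr_gt0 // ltr_pdivrMr // mul1r.
  by rewrite ltr_norml; lra.
have gt1 i : x < u + eps i \/ v + eps i < x -> 1 < `|scaled ((u + v) / 2 + eps i) ((v - u) / 2) x|.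
  move=> h; rewrite /scaled normrM [X in _ * X]gtr0_norm ?invr_gt0 // ltr_pdivlMr // mul1r.
  by rewrite ltNge; apply/negP; rewrite ler_norml => /andP[? ?]; case: h => h; lra.
apply: cvg_near_cst; have [xu|ux] := leP x u.
  rewrite memNset /= ?in_itv /= ?ltNge ?xu //; near=> i.
  have h : x < u + eps i by have := eps0 i; lra.
  by have := gt1 i (or_introl h); rewrite /unit_window; case: ltgtP.
have near_eps (d : R) : 0 < d -> \forall i \near \oo, eps i < d.
  by move=> d0; exact: (near_infty_natSinv_lt (PosNum d0)).
have [xv|vx] := leP x v.
  rewrite mem_set /= ?in_itv /= ?ux ?xv //; near=> i.
  have e : eps i < x - u by near: i; apply: near_eps; rewrite subr_gt0.
  have h1 : u + eps i < x by lra.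
  have h2 : x < v + eps i by have := eps0 i; lra.
  by rewrite /unit_window lt1.
rewrite memNset /= ?in_itv /= ?ux ?leNgt ?vx //; near=> i.
have e : eps i < x - v by near: i; apply: near_eps; rewrite subr_gt0.
have h : v + eps i < x by lra.
by have := gt1 i (or_intror h); rewrite /unit_window; case: ltgtP.
Unshelve. all: by end_near. Qed.

(** The integrals agree on half-open intervals, which generate the Borel sets. *)
Lemma cauchy_transform_unique (B : set (measurableTypeR R)) : measurable B -> m1 B = m2 B.
Proof.
have itv_eq (u v : R) : m1 `]u, v]%classic = m2 `]u, v]%classic.
  have [uv|vu] := ltP u v; last by rewrite set_itv_ge ?measure0 // bnd_simp -leNgt.
  have mI : measurable (`]u, v]%classic : set (measurableTypeR R)) by exact: measurable_itv.
  have [_ _] := unit_agree_itv uv.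
  by rewrite !integral_indic // setIT.
apply: (@measure_unique _ R (measurableTypeR R) (@ocitv R) (fun k => `](- k%:R), k%:R]%classic)).
- by [].
- exact: ocitvI.
- by move=> k; exact: is_ocitv.
- apply/seteqP; split=> // x _.
  have [k xk] : exists k : nat, `|x| < k%:R.
    by exists (Num.truncn `|x|).+1; exact: truncnS_gt.
  by exists k => //=; rewrite in_itv /=; move: xk; rewrite ltr_norml => /andP[-> /ltW].
- by move=> _ [[u v] _ <-] /=; exact: itv_eq.
- by move=> k; apply: le_lt_trans (probability_le1 _ _) _; rewrite ?ltry //; exact: measurable_itv.
Qed.

End StieltjesUniqueness.

(** * Polynomials of the first and second kind *)

Section PolynomialSolutions.
Variables (R : realType) (p : nat -> {poly R}) (a b : nat -> R).
Hypothesis p0 : p 0%N = 1.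
Hypothesis rec : three_term p a b.
Let C := real_complex R.

Lemma complex_recurrence n : 'X * map_poly C (p n) =
  (a n)%:C *: map_poly C (p n.+1) + (b n)%:C *: map_poly C (p n) +
  (if n is m.+1 then (a m)%:C *: map_poly C (p m) else 0).
Proof.
rewrite -(map_polyX C) -rmorphM rec.2 !rmorphD /= !map_polyZ.
by case: n => [|n]; rewrite ?rmorph0 ?map_polyZ.
Qed.

Lemma jacobi_pseq z n : jacobi a b (pseq p z) n = z * pseq p z n.
Proof.
have /= := congr1 (fun P => P.[z]) (complex_recurrence n).
rewrite hornerM hornerX => ->; rewrite /jacobi /pseq.
by case: n => [|n]; rewrite !(hornerE, hornerZ) /=; ring.
Qed.

Lemma pseq0 z : pseq p z 0%N = 1.
Proof. by rewrite /pseq p0 rmorph1 hornerC. Qed.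

Lemma pseq_real x n : pseq p x%:C n = ((p n).[x])%:C.
Proof. by rewrite /pseq -horner_map. Qed.

Lemma pseq_conj x n : Num.conj (pseq p x%:C n) = pseq p x%:C n.
Proof. by rewrite pseq_real conjE conjc_real. Qed.

Lemma divided_differenceD (f g : {poly R[i]}) z x :
  divided_difference (f + g) z x = divided_difference f z x + divided_difference g z x.
Proof. by rewrite /divided_difference; case: ifP => _; rewrite ?derivD !hornerD //; ring. Qed.

Lemma divided_differenceZ c (f : {poly R[i]}) z x :
  divided_difference (c *: f) z x = c * divided_difference f z x.
Proof. by rewrite /divided_difference; case: ifP => _; rewrite ?derivZ !hornerZ //; ring. Qed.

Lemma divided_differenceC (c z x : R[i]) : divided_difference c%:P z x = 0.
Proof. by rewrite /divided_difference derivC !hornerC subrr mul0r if_same. Qed.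

(** The value [f.[x]] on the right becomes, after integration of [f = p n], the
    unit sequence in the recurrence of the polynomials of the second kind. *)
Lemma divided_differenceX (f : {poly R[i]}) z x :
  divided_difference ('X * f) z x = z * divided_difference f z x + f.[x].
Proof.
rewrite /divided_difference derivM derivX mul1r !hornerE.
case: eqP => [->|/eqP xz]; first by rewrite addrC.
by field; rewrite subr_eq0 eq_sym.
Qed.

Variable mu : probability (measurableTypeR R) R.
Hypothesis mu_moments : forall n, mu.-integrable setT (fun x => (x ^+ n)%:E).
Hypothesis p_on : forall n m, (\int[mu]_x ((p n).[x] * (p m).[x]))%R = (n == m)%:R.

Lemma divided_difference_integrable (P : {poly R}) z :
  cintegrable mu (fun x => divided_difference (map_poly C P) z x%:C).
Proof.
have i0 : cintegrable mu (fun=> 0).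
  by apply: cintegrable_real; apply: (@rintegrable_bounded _ mu (fun=> 0) 0) => [|x];
    [exact: measurable_cst|rewrite normr0].
elim/poly_ind: P => [|P c IH].
  rewrite (_ : (fun x => _) = fun=> 0) //.
  by apply/funext => x; rewrite rmorph0 -polyC0 divided_differenceC.
rewrite (_ : (fun x => _) = fun x => z * divided_difference (map_poly C P) z x%:C + (P.[x])%:C).
  apply: cintegrableD; first exact: cintegrableZ.
  exact/cintegrable_real/poly_integrable.
apply/funext => x; rewrite rmorphD rmorphM /= map_polyX map_polyC /= mulrC.
by rewrite divided_differenceD divided_differenceC addr0 divided_differenceX -horner_map.
Qed.

Lemma jacobi_qseq z n : jacobi a b (qseq mu p z) n = z * qseq mu p z n + unit_seq R 0 n.
Proof.
pose F m x := divided_difference (map_poly C (p m)) z x%:C.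
have iF m : cintegrable mu (F m) := divided_difference_integrable (p m) z.
have ip := cintegrable_real (poly_integrable mu_moments (p n)).
have -> : unit_seq R 0 n = Cintegral mu (fun x => ((p n).[x])%:C).
  rewrite Cintegral_real /unit_seq -(rmorph_nat (real_complex R)) /= -p_on.
  by congr (_%:C); congr Rintegral; apply/funext => x; rewrite p0 hornerC mulr1.
have pointwise x : jacobi a b (F^~ x) n = z * F n x + ((p n).[x])%:C.
  have := congr1 (fun P => divided_difference P z x%:C) (complex_recurrence n).
  rewrite /= divided_differenceX horner_map /= => ->; rewrite /F /jacobi.
  case: n {ip} => [|m]; rewrite !divided_differenceD !divided_differenceZ.
    by rewrite -polyC0 divided_differenceC; ring.
  by ring.
change (jacobi a b (fun k => Cintegral mu (F k)) n =
  z * Cintegral mu (F n) + Cintegral mu (fun x => ((p n).[x])%:C)).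
rewrite -(CintegralZ z (iF n)) -(CintegralD (cintegrableZ z (iF n)) ip) jacobi_Cintegral //.
by congr Cintegral; apply/funext.
Qed.

Lemma qseq0 z : qseq mu p z 0%N = 0.
Proof.
rewrite /qseq p0 rmorph1 (_ : (fun x => _) = fun x => (0 : R)%:C).
  by rewrite Cintegral_real Rintegral_cst // mul0r.
by apply/funext => x; rewrite -[1]/(1%:P) divided_differenceC.
Qed.

Lemma qseq_conj x n : Num.conj (qseq mu p x%:C n) = qseq mu p x%:C n.
Proof.
have H : (fun n => Num.conj (qseq mu p x%:C n)) = qseq mu p x%:C.
  apply: (jacobi_solution_unique (b := b) rec.1 (z := x%:C) (f := unit_seq R 0)).
  - move=> k; rewrite jacobi_conj jacobi_qseq rmorphD rmorphM /= !conjE conjc_real.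
    by rewrite /unit_seq rmorph_nat.
  - exact: jacobi_qseq.
  - by rewrite qseq0 rmorph0.
exact: (congr1 (fun f => f n) H).
Qed.

End PolynomialSolutions.

(** * The indeterminate case *)

Section IndeterminateCase.
Variables (R : realType) (s : nat -> R).
Variables (mu : probability (measurableTypeR R) R) (p : nat -> {poly R}) (a b : nat -> R).
Hypothesis s_indet : indeterminate s.
Hypothesis mu_sol : moment_solution s mu.
Hypothesis p_on : orthonormal_polys mu p.
Hypothesis rec : three_term p a b.

Lemma moment_solution_poly (nu1 nu2 : probability (measurableTypeR R) R) (P : {poly R}) :
  moment_solution s nu1 -> moment_solution s nu2 ->
  (\int[nu1]_x P.[x])%R = (\int[nu2]_x P.[x])%R.
Proof.
move=> [_ nu1s] [_ nu2s].
have i1 Q := poly_integrable (fun n => (nu1s n).1) Q.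
have i2 Q := poly_integrable (fun n => (nu2s n).1) Q.
suff H k : (\int[nu1]_x (P * 'X^k).[x])%R = (\int[nu2]_x (P * 'X^k).[x])%R.
  by have := H 0%N; rewrite expr0 mulr1.
elim/poly_ind: P k => [|P c IH] k.
  have int0 (nu : probability (measurableTypeR R) R) : (\int[nu]_x (0 : {poly R}).[x])%R = 0.
    by under eq_Rintegral do rewrite horner0; rewrite Rintegral_cst // mul0r.
  by rewrite mul0r !int0.
have e x : ((P * 'X + c%:P) * 'X^k).[x] = (P * 'X^(k.+1)).[x] + c * ('X^k).[x].
  by rewrite !hornerE exprS; ring.
rewrite (_ : (fun x => _) = fun x => (P * 'X^(k.+1)).[x] + c * ('X^k).[x]); last exact/funext.
rewrite !RintD ?IH ?RintZ //; try exact: rintegrableZ.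
congr (_ + _ * _); rewrite /Rintegral; congr fine.
under eq_integral do rewrite hornerXn.
under [RHS]eq_integral do rewrite hornerXn.
by rewrite (nu1s k).2 (nu2s k).2.
Qed.

(** Two solutions of the moment problem have Cauchy transforms that differ at
    some nonreal point, and the difference of the two square-summable coefficient
    sequences is a nonzero multiple of [p]. *)
Lemma indeterminate_l2_at_nonreal :
  exists z : R[i], l2 (pseq p z) /\ l2 (qseq mu p z).
Proof.
have [_ _ p0 on] := p_on; have [nu1 [nu2 [sol1 sol2 [B mB nu12]]]] := s_indet.
have mom nu : moment_solution s nu -> forall n, nu.-integrable setT (fun x => (x ^+ n)%:E).
  by move=> [_ h] n; exact: (h n).1.
have on' nu : moment_solution s nu ->
    forall n m, (\int[nu]_x ((p n).[x] * (p m).[x]))%R = (n == m)%:R.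
  move=> sol n m; rewrite -on; under eq_Rintegral do rewrite -hornerM.
  under [RHS]eq_Rintegral do rewrite -hornerM.
  exact: moment_solution_poly.
have [z z0 w12] : exists2 z : R[i], Im z != 0 &
    Cintegral nu1 (cauchy_kernel z) <> Cintegral nu2 (cauchy_kernel z).
  apply: contrapT => h; apply: nu12; apply: cauchy_transform_unique => // z z0.
  by apply: contrapT => w12; apply: h; exists z.
exists z.
pose r1 := cauchy_coef nu1 p z; pose r2 := cauchy_coef nu2 p z.
pose w1 := Cintegral nu1 (cauchy_kernel z); pose w2 := Cintegral nu2 (cauchy_kernel z).
have l2r1 : l2 r1 := cauchy_coef_l2 (mom _ sol1) (on' _ sol1) z0.
have l2r2 : l2 r2 := cauchy_coef_l2 (mom _ sol2) (on' _ sol2) z0.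
have Jr1 := jacobi_cauchy_coef (mom _ sol1) (on' _ sol1) p0 rec.2 z0.
have Jr2 := jacobi_cauchy_coef (mom _ sol2) (on' _ sol2) p0 rec.2 z0.
have r1E : r1 = fun n => w1 * pseq p z n + qseq mu p z n.
  apply: (jacobi_solution_unique rec.1 Jr1) => [n|].
    rewrite jacobi_lin (jacobi_pseq rec) (jacobi_qseq p0 rec (mom _ mu_sol) on).
    by ring.
  by rewrite (pseq0 p0) (qseq0 p0) mulr1 addr0 /r1 cauchy_coef0.
have r2E : r2 = fun n => w2 * pseq p z n + qseq mu p z n.
  apply: (jacobi_solution_unique rec.1 Jr2) => [n|].
    rewrite jacobi_lin (jacobi_pseq rec) (jacobi_qseq p0 rec (mom _ mu_sol) on).
    by ring.
  by rewrite (pseq0 p0) (qseq0 p0) mulr1 addr0 /r2 cauchy_coef0.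
have w12' : w1 - w2 != 0 by rewrite subr_eq0; apply/eqP.
have l2p : l2 (pseq p z).
  rewrite (_ : pseq p z = fun n => (w1 - w2)^-1 * (r1 n - r2 n)); first exact/l2Z/l2B.
  by apply/funext => n; rewrite r1E r2E; field.
split=> //; rewrite (_ : qseq mu p z = fun n => - w1 * pseq p z n + r1 n); first exact: l2_lin.
by apply/funext => n; rewrite r1E; ring.
Qed.

Lemma indeterminate_l2 (z : R[i]) : l2 (pseq p z) /\ l2 (qseq mu p z).
Proof.
have [_ _ p0 on] := p_on; have [w [l2p l2q]] := indeterminate_l2_at_nonreal.
have mom n := (mu_sol.2 n).1.
have change gamma c := @l2_change_parameter _ _ _ _ _ _ rec.1 (jacobi_pseq rec w) (pseq0 p0 w)
  (jacobi_qseq p0 rec mom on w) (qseq0 p0 mu w) l2p l2q z gamma c.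
split; [apply: (change 0)|apply: (change 1)] => n.
  by rewrite (jacobi_pseq rec) mul0r addr0.
by rewrite (jacobi_qseq p0 rec mom on) mul1r.
Qed.

End IndeterminateCase.

(** * Supports of the N-extremal measures *)

Lemma absorb_small_term (R : realType) (K y eps f m : R) : 0 <= K -> 0 <= y -> eps * K <= 2^-1 ->
  f <= eps * y -> y <= m + K * f -> y <= 2 * m.
Proof.
move=> K0 y0 epsK f_le y_le.
have h1 := ler_wpM2l K0 f_le; have h2 := ler_wpM2r y0 epsK.
by lra.
Qed.


Lemma no_gap (R : realType) (K y eps f U N beta : R) : 0 <= K -> 0 <= eps ->
  f <= eps * y -> y <= 2 * (U * N) -> 2 * eps * K * N < beta -> 0 < U ->
  U * beta <= K * f -> False.
Proof.
move=> K0 eps0 f_le y_le gap U0 beta_le.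
have h1 := ler_wpM2l K0 f_le; have h2 := ler_wpM2l (mulr_ge0 K0 eps0) y_le.
have h3 : U * (2 * eps * K * N) < U * beta by rewrite ltr_pM2l.
by lra.
Qed.


Section NextremalSupport.
Variables (R : realType) (a b : nat -> R) (P Q : R[i] -> nat -> R[i]).
Hypothesis a_gt0 : forall n, 0 < a n.
Hypothesis JP : forall z n, jacobi a b (P z) n = z * P z n.
Hypothesis P0 : forall z, P z 0%N = 1.
Hypothesis JQ : forall z n, jacobi a b (Q z) n = z * Q z n + unit_seq R 0 n.
Hypothesis Q0 : forall z, Q z 0%N = 0.
Hypothesis P_conj : forall (x : R) n, Num.conj (P x%:C n) = P x%:C n.
Hypothesis Q_conj : forall (x : R) n, Num.conj (Q x%:C n) = Q x%:C n.
Hypothesis l2P : forall z, l2 (P z).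
Hypothesis l2Q : forall z, l2 (Q z).
Variables (t : option R) (E : set R -> (nat -> R[i]) -> (nat -> R[i])).
Local Notation D := (dom_Tt a b (P 0) (Q 0) t).
Local Notation J := (jacobi a b).
Local Notation bform := (boundary_form a b).
Local Notation v := (extension_vector (P 0) (Q 0) t).
Hypothesis E_spec : spectral_measure D J E.
Implicit Types (c d f u w : nat -> R[i]).

Let JPE z : J (P z) = fun n => z * P z n. Proof. exact/funext/JP. Qed.
Let JQE z : J (Q z) = fun n => z * Q z n + unit_seq R 0 n. Proof. exact/funext/JQ. Qed.

Let PM z : max_dom a b (P z) := p_max_dom (JP z) (@l2P z).
Let QM z : max_dom a b (Q z) := q_max_dom (JQ z) (@l2Q z).
Let e0_l2 : l2 (unit_seq R 0) := finsupp_l2 (unit_seq_finsupp R 0).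

Let DP c : D c <-> max_dom a b c /\ bform c v = 0.
Proof.
exact: (dom_TtP a_gt0 (JP 0) (P0 0) (JQ 0) (Q0 0) (P_conj 0) (Q_conj 0) (@l2P 0) (@l2Q 0)).
Qed.

Let vM : max_dom a b v.
Proof. exact: (extension_vector_max_dom (JP 0) (JQ 0) (@l2P 0) (@l2Q 0)). Qed.

Let D_lin alpha c d : D c -> D d -> D (fun n => alpha * c n + d n).
Proof.
move=> /DP[cM c0] /DP[dM d0]; apply/DP; split; first exact: max_dom_lin.
by rewrite boundary_form_lin // c0 d0 mulr0 addr0.
Qed.

Let J_lin alpha c d : J (fun n => alpha * c n + d n) = fun n => alpha * J c n + J d n.
Proof. exact: jacobi_lin. Qed.

Let J_l2 c : D c -> l2 (J c). Proof. by move=> /DP[[]]. Qed.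

Let D_unit k : D (unit_seq R k).
Proof.
have [uM u0] := dom_T_max_dom (finsupp_dom_T a b (unit_seq_finsupp R k)).
by apply/DP; split=> //; exact: u0.
Qed.

Let D_sym c d : D c -> D d -> bform c d = 0.
Proof.
by move=> Dc Dd; rewrite /boundary_form (A_symmetric E_spec D_lin J_lin J_l2) // subrr.
Qed.

(** For real [x] the entries of [P x] are real, so the sums in the Nevanlinna
    functions are inner products. *)
Lemma boundary_form_P z (x : R) :
  bform (P z) (P x%:C) = nevanlinna_D P z x%:C.
Proof.
rewrite /boundary_form !JPE innerZl ?innerZr // conjE conjc_real -mulrBl.
rewrite /nevanlinna_D; congr (_ * csum _); apply/funext => n.
by rewrite P_conj.
Qed.

Lemma boundary_form_Q z (x : R) :
  bform (Q z) (P x%:C) = nevanlinna_C P Q z x%:C.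
Proof.
rewrite /boundary_form JQE JPE inner_linl // innerZr // inner_unitl P0 rmorph1.
rewrite conjE conjc_real /nevanlinna_C.
have -> : csum (fun k => Q z k * P x%:C k) = inner (Q z) (P x%:C).
  by congr csum; apply/funext => n; rewrite P_conj.
by ring.
Qed.

Lemma eigenvector_supp (x : R) : D (P x%:C) -> supp (nextremal E) x.
Proof.
move=> Dp; apply: (eigenvalue_supp E_spec D_lin J_lin J_l2 D_unit (k := 0) Dp (JPE _)).
by rewrite P0 oner_neq0.
Qed.

(** The projection [u] of [e_0] to a small interval around [x] is a nonzero
    approximate eigenvector. By variation of constants it is a multiple of [P x]
    up to a small relative error, so [P x] satisfies the boundary condition of
    [T_t] up to an arbitrarily small error. *)
Lemma supp_eigenvector (x : R) : supp (nextremal E) x -> D (P x%:C).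
Proof.
move=> sx; apply/DP; split; first exact: PM.
set p := P x%:C; set q := Q x%:C.
have [l2p l2q] : l2 p /\ l2 q by split; [exact: l2P|exact: l2Q].
have [l2v l2Jv] := vM.
apply: Normc.eq0_normc; apply/eqP; rewrite eq_le normc_ge0 andbT.
set beta := Normc.normc (bform p v).
rewrite leNgt; apply/negP => beta0.
pose K := green_bound p q.
have K0 : 0 <= K := green_bound_ge0 p q.
pose K' := (`|x| * K + 1) * l2norm v + K * l2norm (J v).
have K'0 : 0 <= K' by rewrite addr_ge0 // mulr_ge0 ?l2norm_ge0 // addr_ge0 // mulr_ge0.
pose N := l2norm p; have N0 : 0 <= N := l2norm_ge0 p.
(* The first two terms of [S] let the error be absorbed by [u], the last one
   makes it too small to compensate the defect [beta]. *)
pose S := 1 + 2 * K + (4 * K' * N) / beta.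
have h : 0 <= 4 * K' * N / beta by rewrite divr_ge0 ?mulr_ge0 // ltW.
have S0 : 0 < S by rewrite /S; lra.
pose eps := S^-1; have eps0 : 0 < eps by rewrite invr_gt0.
have epsK : eps * K <= 2^-1.
  rewrite /eps mulrC ler_pdivrMr //.
  by rewrite /S; lra.
have epsK' : 2 * eps * K' * N < beta.
  rewrite /eps (_ : _ * _ = (2 * K' * N) / S); last by ring.
  rewrite ltr_pdivrMr // (_ : beta * S = beta * (1 + 2 * K) + 4 * (K' * N)); last first.
    by rewrite /S; field; rewrite gt_eqF.
  have h1 : 0 <= K' * N by rewrite mulr_ge0.
  have h2 : 0 <= beta * K by rewrite mulr_ge0 // ltW.
  by move: h1 h2 beta0; lra.
pose B := `]x - eps, x + eps[%classic : set (measurableTypeR R).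
have mB : measurable B by exact: measurable_itv.
pose u := E B (unit_seq R 0).
have uB : in_range E B u := in_rangeE E_spec mB e0_l2.
have l2u : l2 u := uB.1.
have u_gt0 : 0 < l2norm u.
  have oB : open (B : set R) by exact: itv_open.
  have := sx B oB; rewrite /nextremal /= (inner_E E_spec mB e0_l2) /= lte_fin => pos.
  rewrite lt_def l2norm_ge0 andbT; apply: contraTneq (pos _) => [u0|].
    by rewrite -/u u0 expr0n ltxx.
  by rewrite /B /= in_itv /=; apply/andP; split; lra.
have [Du] := approximate_eigenvector E_spec D_lin J_lin J_l2 D_unit eps0 uB.
set f := fun n => _; move=> f_le.
have l2f : l2 f by exact: l2B (J_l2 Du) (l2Z l2u).
pose g := green p q f.
have uE : u = fun n => u 0%N * p n + g n.
  apply: (variation_of_constants a_gt0 (JP _) (P0 _) (JQ _) (Q0 _)) => n.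
  by rewrite /f addrC subrK.
have gM : max_dom a b g := green_max_dom (JP _) (P0 _) (JQ _) (Q0 _) l2p l2q l2f.
have g_le : l2norm g <= K * l2norm f := l2norm_green l2p l2q l2f.
have JgE : J g = fun n => x%:C * g n + f n.
  exact/funext/(jacobi_green (JP _) (P0 _) (JQ _) (Q0 _)).
have gv_le : Normc.normc (bform g v) <= K' * l2norm f.
  have [l2g l2Jg] := gM.
  rewrite /boundary_form; apply: le_trans (normcB _ _) _.
  apply: le_trans (lerD (cauchy_schwarz l2Jg l2v) (cauchy_schwarz l2g l2Jv)) _.
  have hJ : l2norm (J g) <= (`|x| * K + 1) * l2norm f.
    rewrite JgE; apply: le_trans (l2normD (l2Z l2g) l2f) _.
    rewrite l2normZ // normc_real mulrDl mul1r lerD2r -mulrA.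
    by rewrite ler_wpM2l.
  have := ler_wpM2r (l2norm_ge0 v) hJ; have := ler_wpM2r (l2norm_ge0 (J v)) g_le.
  by rewrite /K'; lra.
have [_ uv] := (DP u).1 Du.
have split_uv : u 0%N * bform p v + bform g v = 0.
  by rewrite -boundary_form_lin //; [rewrite -uE|exact: PM].
pose U := Normc.normc (u 0%N).
have U0 : 0 <= U := normc_ge0 _.
have u_le : l2norm u <= U * N + K * l2norm f.
  rewrite {1}uE; apply: le_trans (l2normD (l2Z l2p) gM.1) _.
  by rewrite l2normZ // lerD2l.
have {}u_le := absorb_small_term K0 (ltW u_gt0) epsK f_le u_le.
have U_gt0 : 0 < U.
  rewrite lt_def U0 andbT; apply: contraTneq u_gt0 => e.
  by rewrite -leNgt (le_trans u_le) // e mul0r mulr0.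
have : U * beta <= K' * l2norm f.
  rewrite /U /beta -Normc.normcM (_ : u 0%N * bform p v = - bform g v) ?normcN //.
  by apply/eqP; rewrite -subr_eq0 opprK split_uv.
exact: no_gap K'0 (ltW eps0) f_le u_le epsK' U_gt0.
Qed.

(** The complement of the support is a countable union of null intervals with
    rational ends, whereas the weight of [e_0] has mass 1. *)
Lemma supp_nonempty : exists x : R, supp (nextremal E) x.
Proof.
apply: contrapT => nosupp.
have [m [mE mT _ _]] := spectral_weight E_spec e0_l2.
pose I (k : nat) : set R := if unpickle k is Some (r1, r2) then
    (if m `](ratr r1 : R), (ratr r2 : R)[%classic == 0%E then `](ratr r1 : R), (ratr r2 : R)[%classic else set0)
  else set0.
have I0 k : m.-negligible (I k).
  rewrite /I; case: (unpickle k) => [[r1 r2]|]; last exact: negligible_set0.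
  case: eqP => [e|_]; last exact: negligible_set0.
  by apply/negligibleP => //; exact: measurable_itv.
have cover : setT `<=` \bigcup_k I k.
  move=> x _.
  have [U [oU Ux mU]] : exists U : set R, [/\ open U, U x & m U = 0%E].
    apply: contrapT => h; apply: nosupp; exists x => U oU Ux.
    have mU : measurable (U : set (measurableTypeR R)) by exact: open_measurable.
    rewrite /nextremal (inner_E E_spec mU e0_l2) /= -(mE _ mU) lt_def measure_ge0 andbT.
    by apply/eqP => e; apply: h; exists U.
  have /nbhs_ballP[eps /= eps0 epsU] := open_nbhs_nbhs (conj oU Ux).
  have [r1 r1x] := @rat_in_itvoo R (x - eps) x ltac:(lra).
  have [r2 r2x] := @rat_in_itvoo R x (x + eps) ltac:(lra).
  move: r1x r2x; rewrite !in_itv /= => /andP[h1 h2] /andP[h3 h4].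
  have mU' : measurable (U : set (measurableTypeR R)) by exact: open_measurable.
  have itv0 : m `](ratr r1 : R), (ratr r2 : R)[%classic = 0%E.
    apply/eqP; rewrite eq_le measure_ge0 andbT -mU.
    apply: le_measure; rewrite ?inE //.
    move=> y; rewrite /= in_itv /= => /andP[y1 y2]; apply: epsU.
    by rewrite /ball /= ltr_norml; lra.
  have IE : I (pickle (r1, r2)) = `](ratr r1 : R), (ratr r2 : R)[%classic.
    by rewrite /I pickleK itv0 eqxx.
  exists (pickle (r1, r2)); first by [].
  rewrite IE.
  by rewrite /= in_itv /= h2 h3.
have : m setT = 0%E.
  have neg : m.-negligible (\bigcup_k I k) := negligible_bigcup I0.
  apply/(negligibleP m measurableT); exact: negligibleS neg.
rewrite mT => -[] /eqP; rewrite sqrf_eq0 => /eqP /(l2norm0_eq0 e0_l2) /(congr1 (fun f => f 0%N)).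
by rewrite /unit_seq eqxx => /eqP; rewrite oner_eq0.
Qed.

(** One support point suffices: an eigenvector of [T_t] is not in the domain
    of [T], so it spans [D(T_t)] modulo [D(T)]. *)
Lemma domain_boundary_criterion c : max_dom a b c ->
  D c <-> forall x : R, supp (nextremal E) x -> bform c (P x%:C) = 0.
Proof.
move=> cM; split=> [Dc x /supp_eigenvector|]; first exact: D_sym.
have [x sx] := supp_nonempty => /(_ x sx) cp.
have [d dT [alpha pE]] := supp_eigenvector sx.
have {}pE : P x%:C = fun n => alpha * v n + d n.
  by rewrite pE; apply/funext => n; rewrite addrC.
have [dM d0] := dom_T_max_dom dT.
have alpha0 : alpha != 0.
  apply/eqP => e.
  have pd : P x%:C = d by rewrite pE e; apply/funext => n; rewrite mul0r add0r.
  have := d0 _ (QM x%:C); rewrite -pd.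
  rewrite /boundary_form JPE JQE innerZl // inner_linr // inner_unitr // P0.
  rewrite conjE conjc_real opprD addrA subrr sub0r => /eqP.
  by rewrite oppr_eq0 oner_eq0.
apply/DP; split=> //; move: cp; rewrite pE boundary_form_linr //.
rewrite (boundary_form_conj dM cM) d0 // rmorph0 oppr0 addr0 => /eqP.
by rewrite mulf_eq0 fmorph_eq0 (negbTE alpha0) => /eqP.
Qed.

Lemma eigenvalue_real z : D (P z) -> z = (Re z)%:C.
Proof.
move=> Dp; have := inner_A_real E_spec Dp; rewrite JPE innerZl // inner_norm //.
have n0 : l2norm (P z) ^+ 2 != 0.
  rewrite sqrf_eq0; apply/eqP => /(l2norm0_eq0 (@l2P z)) /(congr1 (fun f => f 0%N)).
  by rewrite P0 => /eqP; rewrite oner_eq0.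
rewrite ImM /= mulr0 add0r => /eqP; rewrite mulf_eq0 (negbTE n0) orbF.
by case: z {Dp n0} => z1 z2 /= /eqP ->.
Qed.

Lemma nevanlinna_criteria (lambda : R[i]) :
  [/\ D (P lambda) <->
        (forall x : R, supp (nextremal E) x -> nevanlinna_D P lambda x%:C = 0),
      (forall x : R, supp (nextremal E) x -> nevanlinna_D P lambda x%:C = 0) <->
        (exists2 x : R, supp (nextremal E) x & lambda = x%:C)
    & D (Q lambda) <->
        (forall x : R, supp (nextremal E) x -> nevanlinna_C P Q lambda x%:C = 0)].
Proof.
have hP : D (P lambda) <->
    (forall x : R, supp (nextremal E) x -> nevanlinna_D P lambda x%:C = 0).
  apply: (iff_trans (domain_boundary_criterion (PM lambda))).
  by split=> h x /h; rewrite boundary_form_P.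
split=> //.
  rewrite -hP; split=> [Dp|[x sx ->]]; last exact: supp_eigenvector.
  have e := eigenvalue_real Dp; exists (Re lambda) => //.
  by apply: eigenvector_supp; rewrite -e.
apply: (iff_trans (domain_boundary_criterion (QM lambda))).
by split=> h x /h; rewrite boundary_form_Q.
Qed.

End NextremalSupport.

Theorem theorem3p4 (R : realType) (s : nat -> R)
    (s0 : s 0%N = 1) (s_indet : indeterminate s)
    (mu : probability (measurableTypeR R) R) (mu_sol : moment_solution s mu)
    (p : nat -> {poly R}) (p_on : orthonormal_polys mu p)
    (a b : nat -> R) (ab_rec : three_term p a b)
    (t : option R)
    (E : set R -> (nat -> R[i]) -> (nat -> R[i]))
    (E_spec : spectral_measure (dom_Tt a b (pseq p 0) (qseq mu p 0) t)
                               (jacobi a b) E)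
    (lambda : R[i]) :
  [/\ dom_Tt a b (pseq p 0) (qseq mu p 0) t (pseq p lambda) <->
        (forall x : R, supp (nextremal E) x ->
           nevanlinna_D (pseq p) lambda x%:C = 0),
      (forall x : R, supp (nextremal E) x ->
         nevanlinna_D (pseq p) lambda x%:C = 0) <->
        (exists2 x : R, supp (nextremal E) x & lambda = x%:C)
    & dom_Tt a b (pseq p 0) (qseq mu p 0) t (qseq mu p lambda) <->
        (forall x : R, supp (nextremal E) x ->
           nevanlinna_C (pseq p) (qseq mu p) lambda x%:C = 0)].
Proof.
have [_ _ p0 on] := p_on.
have mom n := (mu_sol.2 n).1.
have l2pq := indeterminate_l2 s_indet mu_sol p_on ab_rec.
apply: (@nevanlinna_criteria R a b (pseq p) (qseq mu p)) => //.
- exact: ab_rec.1.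
- exact: (jacobi_pseq ab_rec).
- exact: pseq0.
- exact: (jacobi_qseq p0 ab_rec mom on).
- exact: qseq0.
- exact: pseq_conj.
- exact: (qseq_conj p0 ab_rec mom on).
- by move=> z; have [] := l2pq z.
- by move=> z; have [] := l2pq z.
Qed.
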